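(* Let $G$ be a countable discrete amenable group acting continuously on a compact metric space $(X,d)$. Let $\mu\in E(X,G)$ be a $G$-ergodic Borel probability measure on $X$, and let $\{F_n\}$ be a tempered Følner sequence in $G$ with $\lim_{n\to+\infty}\frac{|F_n|}{\log n}=\infty$. Then for every $\delta\in(0,1)$, $$\lim_{\epsilon\to0}\liminf_{n\to+\infty}\frac{1}{|F_n|}\log N(F_n,\epsilon,\delta)=\lim_{\epsilon\to0}\limsup_{n\to+\infty}\frac{1}{|F_n|}\log N(F_n,\epsilon,\delta)=h_\mu(X,G),$$ where, for a finite subset $F\subset G$, $N(F,\epsilon,\delta)$ is the minimal number of Bowen balls $B_F(x,\epsilon)$ ($x\in X$) whose union covers a set of $\mu$-measure no less than $1-\delta$.
   Context: $E(X,G)$ denotes the set of $G$-ergodic ($G$-invariant) Borel probability measures on $X$. A Følner sequence in $G$ is a sequence $\{F_n\}$ of nonempty finite subsets of $G$ with $\lim_{n\to\infty}\frac{|F_n\triangle gF_n|}{|F_n|}=0$ for all $g\in G$; $G$ is amenable if such a sequence exists. $\{F_n\}$ is tempered if there is a constant $C$ independent of $n$ with $|\bigcup_{k<n}F_k^{-1}F_n|\le C|F_n|$ for all $n$. For finite $F\subset G$ and $\epsilon>0$, $B_F(x,\epsilon)=\{y\in X: d(gx,gy)<\epsilon\text{ for all }g\in F\}$. Measure entropy: for a finite measurable partition $\mathcal{P}$ of $X$, let $\mathcal{P}_F=\bigvee_{g\in F}g^{-1}\mathcal{P}$ (where $\mathcal{P}\vee\mathcal{Q}=\{P\cap Q:P\in\mathcal{P},Q\in\mathcal{Q}\}$),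 $H_\mu(\mathcal{P})=-\sum_{P\in\mathcal{P}}\mu(P)\log\mu(P)$, $h_\mu(G,\mathcal{P})=\liminf_{n\to\infty}\frac{1}{|F_n|}H_\mu(\mathcal{P}_{F_n})$ (independent of the Følner sequence), and $h_\mu(X,G)=\sup_{\mathcal{P}}h_\mu(G,\mathcal{P})\in[0,\infty]$ over finite measurable partitions. *)

(* Defs.v *)
From HB Require Import structures.
From mathcomp Require Import all_boot all_order all_algebra finmap.
From mathcomp Require Import all_classical all_reals all_analysis.
Import Order.TTheory GRing.Theory Num.Theory.
Import numFieldNormedType.Exports.

Set Implicit Arguments.
Unset Strict Implicit.
Unset Printing Implicit Defensive.

Local Open Scope classical_set_scope.
Local Open Scope ring_scope.

(* The library puts a measurable structure on a type only if it is pointed;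
   this costs no generality for a space that carries a probability measure. *)
#[short(type="pointedMetricType")]
HB.structure Definition PointedMetric (R : numDomainType) :=
  { M of Metric R M & isPointed M }.

Definition borel (R : realType) (X : pointedMetricType R) :=
  g_sigma_algebraType (@open X).

Section Folner.
Context (R : realType) (G : groupType).
Local Open Scope fset_scope.

Definition translate (g : G) (F : {fset G}) : {fset G} :=
  [fset (g * h)%g | h in F].

Definition symdiff (A B : {fset G}) : {fset G} := (A `\` B) `|` (B `\` A).

Definition Folner (F : nat -> {fset G}) : Prop :=
  (forall n, F n != fset0) /\
  (forall g : G,
    (#|` symdiff (F n) (translate g (F n))|%:R / #|` F n|%:R : R)
      @[n --> \oo] --> (0 : R)).

Definition amenable : Prop := exists F : nat -> {fset G}, Folner F.

Definition tempered (F : nat -> {fset G}) : Prop :=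
  exists C : R, forall n : nat,
    #|` \big[fsetU/fset0]_(k < n) [fset (a^-1 * b)%g | a in F k, b in F n] |%:R
      <= C * #|` F n|%:R.

End Folner.

(* [G] is discrete, so joint continuity of the action is continuity of each
   of its maps. *)
Record continuous_action (R : realType) (G : groupType)
    (X : pointedMetricType R) (act : G -> X -> X) : Prop := {
  act1 : forall x, act 1%g x = x ;
  actM : forall (g h : G) x, act (g * h)%g x = act g (act h x) ;
  act_continuous : forall g : G, continuous (act g) }.

Section Dynamics.
Context (R : realType) (G : groupType) (X : pointedMetricType R).
Variables (act : G -> X -> X) (mu : probability (borel X) R).

Definition invariant : Prop :=
  forall (g : G) (A : set (borel X)), measurable A ->
    mu (act g @^-1` A) = mu A.

Definition ergodic : Prop :=
  invariant /\
  forall A : set (borel X), measurable A ->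
    (forall g : G, act g @^-1` A = A) -> mu A = 0%E \/ mu A = 1%E.

Definition bowen_ball (F : {fset G}) (x : X) (e : R) : set X :=
  [set y | forall g : G, g \in F -> mdist (act g x) (act g y) < e].

(* +oo if no finite family of balls qualifies; otherwise the infimum is a
   minimum. *)
Definition covering_number (F : {fset G}) (e delta : R) : \bar R :=
  ereal_inf [set k%:R%:E | k in [set k : nat |
    exists (c : 'I_k -> X) (A : set (borel X)),
      [/\ measurable A,
          A `<=` \bigcup_(i in [set: 'I_k]) bowen_ball F (c i) e
        & ((1 - delta)%:E <= mu A)%E]]].

Definition finite_measurable_partition (P : set (set (borel X))) : Prop :=
  [/\ finite_set P, (forall A, P A -> measurable A) & partition P id setT].

Definition join (P Q : set (set (borel X))) : set (set (borel X)) :=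
  [set A `&` B | A in P & B in Q].

Definition refine (P : set (set (borel X))) (F : {fset G}) :
    set (set (borel X)) :=
  \big[join/[set setT]]_(g <- F) [set act g @^-1` A | A in P].

(* An empty member of [P] contributes nothing, as [0 * ln 0 = 0]. *)
Definition partition_entropy (P : set (set (borel X))) : R :=
  - \sum_(A \in P) (fine (mu A) * ln (fine (mu A))).

Definition entropy_of (F : nat -> {fset G}) (P : set (set (borel X))) : \bar R :=
  limn_einf (fun n =>
    ((#|` F n|%:R)^-1 * partition_entropy (refine P (F n)))%:E).

(* The argument [F] only selects the Folner sequence used in the definition:
   the value is the same along every Folner sequence. *)
Definition measure_entropy (F : nat -> {fset G}) : \bar R :=
  ereal_sup [set entropy_of F P | P in finite_measurable_partition].

Definition covering_rate (F : nat -> {fset G}) (e delta : R) (n : nat) : \bar R :=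
  ((#|` F n|%:R)^-1%:E * lne (covering_number (F n) e delta))%E.

End Dynamics.

(* Main.v *)
Require Import Defs.
From HB Require Import structures.
From mathcomp Require Import all_boot all_order all_algebra finmap.
From mathcomp Require Import all_classical all_reals all_analysis.
From mathcomp Require Import measurable_realfun ring lra.
Import Order.TTheory GRing.Theory Num.Theory.
Import numFieldNormedType.Exports.

(** Katok's entropy formula says that, at the exponential scale, covering a set
    of positive mass by Bowen balls costs as much as covering it by cells of
    the refined partitions. Fix a finite partition, given by a labelling [p] of
    the points. The [F]-name of [x] is the family of labels of the points [g x],
    [g] in [F]; the cells of the refined partition are the sets of points with
    a given name. Let [h] be the entropy of the partition along the sequence.

    Few names suffice ([typical_names_rate]). Choose a set [K] of the sequence
    whose name entropy is close to [h] times its cardinal. Shearer's inequality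
    replaces a tiling of [F] by translates of [K]: all the translates [K j] that
    meet [F] together cover each element of [F] exactly [#|K|] times, so, with
    [q] the law of the [K]-names, a Hoelder inequality ([shearer_expR]) bounds
    the sum over all [F]-names of the product over [j] of
    [q (K-name at j) ^ (1 / #|K|)]; the bound has a constant factor to the power
    [1 / #|K|] for each translate inside [F], and only the few translates that
    meet the boundary of [F] cost more ([name_count]). By the mean ergodic
    theorem applied to [- ln q], this product is at least about
    [exp (- h #|F|)] for the names of most points. Hence about [exp (h #|F|)]
    names carry almost all the mass.

    Fewer names do not ([many_names]). If a family of fewer than
    [exp ((h - eta) #|F|)] names carried a positive mass, then, the rest of the
    mass being carried by about [exp (h #|F|)] names, Gibbs' inequality would
    make the entropy of the [F]-names smaller than [h #|F|] by a definite
    proportion ([entropy_grouping]).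

    From names to Bowen balls. If the cells have diameter less than [e], every
    cell of the refined partition lies in a Bowen ball of radius [e], which
    gives the upper bound ([covering_number_le]). For the lower bound, a Borel
    partition separates points well off a set [B] of small measure
    ([borel_separation]): two points of a Bowen ball whose orbits seldom visit
    [B] have names that differ at few places. A Hamming ball of small radius
    has few elements ([hamming_ball_card]), so a covering by few Bowen balls
    would yield a positive mass carried by too few names
    ([covering_number_lower]).

    The mean ergodic theorem is proved by a variational argument. The second
    moment of the averages of [f] tends to the least second moment of an
    average of translates of [f]; the parallelogram identity then makes the
    averages Cauchy and asymptotically invariant, and ergodicity identifies
    the limit ([energy_floor], [avg_cauchy], [ergodic_const]). *)

Set Implicit Arguments.
Unset Strict Implicit.
Unset Printing Implicit Defensive.

Local Open Scope ring_scope.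

(** * Shearer's inequality and Hamming balls *)

Section Shearer.
Context {R : realType}.

(** Convexity of the exponential: average the tangent line at the mean. *)
Lemma expR_mean_le (U : Type) (s : seq U) (P : pred U) (v : U -> R) :
  (0 < count P s)%N ->
  expR ((\sum_(j <- s | P j) v j) / (count P s)%:R) <=
  (\sum_(j <- s | P j) expR (v j)) / (count P s)%:R.
Proof.
move=> m_gt0; have m0 : 0 < (count P s)%:R :> R by rewrite ltr0n.
set a := (X in expR X).
have -> : expR a = (\sum_(j <- s | P j) expR a * (1 + (v j - a))) / (count P s)%:R.
  rewrite -mulr_sumr !big_split /= sumrN !big_const_seq !iter_addr_0.
  rewrite -[in LHS](mulr1 (expR a)) -mulrA; congr (_ * _).
  have -> : \sum_(j <- s | P j) v j = a * (count P s)%:R.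
    by rewrite /a divfK// gt_eqF.
  by rewrite mulr_natr subrr addr0 divff// gt_eqF.
rewrite ler_pM2r ?invr_gt0//; apply: ler_sum => j _.
rewrite -{2}[v j](subrKC a) expRD ler_pM2l ?expR_gt0//.
exact: expR_ge1Dx.
Qed.

(** Hoelder's inequality for as many functions as the exponents 1/m allow,
    written for positive functions [expR (u j t)] to avoid real powers. After
    normalising each function to have sum 1 it follows from [expR_mean_le]. *)
Lemma hoelder_expR (U : Type) (T : finType) (s : seq U) (P : pred U)
    (u : U -> T -> R) :
  (0 < count P s)%N ->
  \sum_(t : T) expR ((\sum_(j <- s | P j) u j t) / (count P s)%:R) <=
  expR ((\sum_(j <- s | P j) ln (\sum_(t : T) expR (u j t))) / (count P s)%:R).
Proof.
move=> m_gt0; have m0 : 0 < (count P s)%:R :> R by rewrite ltr0n.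
have [t0 _|T0] := pickP T; last by rewrite big_pred0 ?expR_ge0.
set L := fun j => ln (\sum_(t : T) expR (u j t)).
have Lgt0 j : 0 < \sum_(t : T) expR (u j t).
  rewrite (bigD1 t0)//=; apply: ltr_pwDl; first exact: expR_gt0.
  by apply: sumr_ge0 => t _; exact: expR_ge0.
have -> : \sum_(t : T) expR ((\sum_(j <- s | P j) u j t) / (count P s)%:R) =
    expR ((\sum_(j <- s | P j) L j) / (count P s)%:R) *
    \sum_(t : T) expR ((\sum_(j <- s | P j) (u j t - L j)) / (count P s)%:R).
  rewrite mulr_sumr; apply: eq_bigr => t _.
  by rewrite -expRD -mulrDl -big_split/=; under [in RHS]eq_bigr do rewrite subrKC.
rewrite ger_pMr ?expR_gt0//.
apply: (@le_trans _ _ (\sum_(t : T) (\sum_(j <- s | P j) expR (u j t - L j)) / (count P s)%:R)).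
  by apply: ler_sum => t _; exact: expR_mean_le.
rewrite -mulr_suml exchange_big/= ler_pdivrMr// mul1r.
rewrite (_ : (count P s)%:R = \sum_(j <- s | P j) 1); last first.
  by rewrite big_const_seq iter_addr_0.
apply: ler_sum => j _.
under eq_bigr do rewrite expRD.
by rewrite -mulr_suml /L expRN lnK ?posrE// divff// gt_eqF.
Qed.

Context {I T : finType}.
Implicit Types (w : {ffun I -> T}) (D : {set I}).

(** Fixing the coordinates outside D lets the sums below be taken one
    coordinate at a time. *)
Definition cyl D w : {set {ffun I -> T}} :=
  [set w' : {ffun I -> T} | [forall i, (i \notin D) ==> (w' i == w i)]].

Lemma cylP D w w' : reflect (forall i, i \notin D -> w' i = w i) (w' \in cyl D w).
Proof.
rewrite inE; apply: (iffP forallP) => [h i iD|h i].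
  by apply/eqP; exact: (implyP (h i)).
by apply/implyP => iD; apply/eqP/h.
Qed.

Definition upd w (i : I) (t : T) : {ffun I -> T} :=
  [ffun j => if j == i then t else w j].

Lemma sum_cyl_upd D w i (f : {ffun I -> T} -> R) : i \notin D ->
  \sum_(w' in cyl (i |: D) w) f w' = \sum_t \sum_(w' in cyl D (upd w i t)) f w'.
Proof.
move=> iD; rewrite (partition_big (fun w' : {ffun I -> T} => w' i) predT)//=.
apply: eq_bigr => t _; apply: eq_bigl => w'.
apply/andP/cylP => [[/cylP h /eqP w'i] j jD|h].
  by rewrite ffunE; case: eqP => [->//|/eqP ji]; apply: h; rewrite !inE negb_or ji.
split; last by rewrite (h i iD) ffunE eqxx.
apply/cylP => j; rewrite !inE negb_or => /andP[ji jD].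
by rewrite (h j jD) ffunE (negPf ji).
Qed.

Lemma sum_cyl_indep D (A : {set I}) w i t (f : {ffun I -> T} -> R) :
  (forall w w', (forall j, j \in A -> w j = w' j) -> f w = f w') ->
  i \notin A -> i \notin D ->
  \sum_(w' in cyl D (upd w i t)) f w' = \sum_(w' in cyl D w) f w'.
Proof.
move=> fA iA iD.
rewrite (reindex_onto (fun w' => upd w' i t) (fun w' => upd w' i (w i)))/=; last first.
  move=> w' /cylP h; apply/ffunP => j; rewrite !ffunE; case: eqP => // ->.
  by rewrite (h i iD) ffunE eqxx.
apply: eq_big => [w'|w' _].
  apply/andP/cylP => [[/cylP h /eqP e] j jD|h].
    move/ffunP: (e) => /(_ j); rewrite !ffunE; case: eqP => [->//|/eqP ji _].
    by move: (h j jD); rewrite !ffunE (negPf ji).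
  split.
    by apply/cylP => j jD; rewrite !ffunE; case: eqP => // _; exact: h.
  apply/eqP/ffunP => j; rewrite !ffunE; case: eqP => // ->.
  by rewrite h.
apply: fA => j jA; rewrite ffunE; case: eqP => // ji.
by move: iA; rewrite -ji jA.
Qed.

(** The weighted form of Shearer's inequality (a discrete Finner inequality).
    Induction on D: splitting off a coordinate i, the functions that do not see
    i factor out of the sum over the values at i, and Hoelder's inequality
    applies to the remaining ones, of which there are exactly m. *)
Lemma shearer_expR (U : Type) (s : seq U) (A : U -> {set I})
    (u : U -> {ffun I -> T} -> R) (m : nat) D :
  (0 < m)%N ->
  (forall j w w', (forall i, i \in A j -> w i = w' i) -> u j w = u j w') ->
  (forall i, i \in D -> count (fun j => i \in A j) s = m) ->
  forall w,
  \sum_(w' in cyl D w) expR ((\sum_(j <- s) u j w') / m%:R) <=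
  expR ((\sum_(j <- s) ln (\sum_(w' in cyl (D :&: A j) w) expR (u j w'))) / m%:R).
Proof.
move=> m_gt0 uA; have [n] := ubnP #|D|; elim: n D => // n IHn D.
have [->|[i iD]] := set_0Vmem D.
  move=> _ _ w.
  have c0 E : cyl (finset.set0 :&: E) w = finset.set1 w.
    apply/setP => w'; rewrite finset.in_set1 finset.set0I; apply/cylP/eqP => [h|-> //].
    by apply/ffunP => i; apply: h; rewrite inE.
  rewrite -(finset.setI0 finset.set0) c0 big_set1.
  by under [in leRHS]eq_bigr do rewrite finset.setI0 c0 big_set1 expRK.
move=> Dn hD w; set D' := D :\ i.
have DE : D = i |: D' by rewrite /D' finset.setD1K.
have iD' : i \notin D' by rewrite !inE eqxx.
have D'n : (#|D'| < n)%N by move: Dn; rewrite (cardsD1 i) iD.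
have hD' j : j \in D' -> count (fun k => j \in A k) s = m.
  by rewrite !inE => /andP[_]; exact: hD.
rewrite {1}DE sum_cyl_upd//.
apply: le_trans; first by apply: ler_sum => t _; exact: IHn.
pose S j t := \sum_(w' in cyl (D' :&: A j) (upd w i t)) expR (u j w').
have S_gt0 j t : 0 < S j t.
  rewrite /S (bigD1 (upd w i t)) /=; last by apply/cylP.
  apply: ltr_pwDl; first exact: expR_gt0.
  by apply: sumr_ge0 => ? _; exact: expR_ge0.
have uAe j w1 w2 : (forall i, i \in A j -> w1 i = w2 i) ->
    expR (u j w1) = expR (u j w2) by move=> h; rewrite (uA _ _ _ h).
pose C := \sum_(j <- s | i \notin A j)
    ln (\sum_(w' in cyl (D :&: A j) w) expR (u j w')).
have -> : \sum_(j <- s) ln (\sum_(w' in cyl (D :&: A j) w) expR (u j w')) =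
    C + \sum_(j <- s | i \in A j) ln (\sum_t expR (ln (S j t))).
  rewrite [LHS](bigID (fun j => i \in A j))/= addrC; congr +%R.
  apply: eq_bigr => j ij; congr ln.
  under [RHS]eq_bigr do rewrite lnK ?posrE//.
  rewrite -sum_cyl_upd; last by rewrite !inE eqxx.
  by apply: eq_bigl => w'; rewrite DE finset.setIUl (finset.setIidPl _)// finset.sub1set.
have hS t : \sum_(j <- s) ln (S j t) = C + \sum_(j <- s | i \in A j) ln (S j t).
  rewrite [LHS](bigID (fun j => i \in A j))/= addrC; congr +%R.
  apply: eq_bigr => j ij; congr ln; rewrite /S.
  rewrite (sum_cyl_indep _ _ (uAe j))//; last by rewrite !inE eqxx.
  apply: eq_bigl => w'; congr (_ \in cyl _ _); apply/finset.setP => k.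
  by rewrite !inE; case: (k =P i) => //= ->; rewrite (negPf ij) andbF.
under eq_bigr do rewrite hS mulrDl expRD.
rewrite -mulr_sumr mulrDl expRD.
rewrite ler_pM2l ?expR_gt0//.
rewrite -(hD i iD); apply: (hoelder_expR (fun j t => ln (S j t))).
by rewrite (hD i iD).
Qed.

(** Give each w' the weight r to the power of its distance to w; the total
    weight is a product over the coordinates. *)
Lemma hamming_ball_card (w : {ffun I -> T}) (d : nat) (r : R) :
  0 < r -> r <= 1 ->
  #|[set w' : {ffun I -> T} | (#|[set i | w' i != w i]| <= d)%N]|%:R * r ^+ d
    <= expR (#|T|%:R * r * #|I|%:R).
Proof.
move=> r0 r1.
apply: (@le_trans _ _ (\sum_(w' : {ffun I -> T}) \prod_i (if w' i == w i then 1 else r))).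
  rewrite -sumr_const mulr_suml (big_mkcond (fun i => i \in _))/=.
  apply: ler_sum => w' _; rewrite inE; case: ifP => [dle|_]; last first.
    by apply: prodr_ge0 => i _; case: ifP => // _; exact: ltW.
  rewrite mul1r (bigID (fun i => w' i == w i))/= big1 ?mul1r; last by move=> i ->.
  rewrite (eq_bigr (fun=> r)); last by move=> i /negPf ->.
  rewrite prodr_const; apply: ler_wiXn2l => //; first exact: ltW.
  by rewrite (leq_trans _ dle)//; apply/eq_leq/eq_card => i; rewrite inE.
rewrite -(bigA_distr_bigA (fun i t => if t == w i then 1 else r)).
rewrite expRM_natr -[leRHS]prodr_const.
apply: ler_prod => i _; apply/andP; split.
  by apply: sumr_ge0 => t _; case: ifP => // _; exact: ltW.
apply: le_trans (expR_ge1Dx _).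
rewrite (bigD1 (w i))//= eqxx lerD2l mulr_natl -sumr_const.
rewrite big_mkcond/=; apply: ler_sum => t _; case: ifP => [/negPf -> //|_].
exact: ltW.
Qed.

End Shearer.

(** * Entropy of finite distributions *)

Section Gibbs.
Context {R : realType} {W : finType}.
Implicit Types p r : W -> R.

(** This follows from [ln x <= x - 1], applied to [r w / p w]. *)
Lemma gibbs p r : (forall w, 0 <= p w) -> \sum_w p w = 1 ->
  (forall w, 0 < r w) -> \sum_w r w <= 1 ->
  - \sum_w p w * ln (p w) <= - \sum_w p w * ln (r w).
Proof.
move=> p0 p1 r0 r1; rewrite lerN2 -subr_le0 -sumrB.
apply: (@le_trans _ _ (\sum_w (r w - p w))); last first.
  by rewrite sumrB p1 subr_le0.
apply: ler_sum => w _; move: (p0 w); rewrite le_eqVlt => /predU1P[<-|pw].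
  by rewrite !mul0r !subr0 ltW.
rewrite -mulrBr -ln_div ?posrE//.
rewrite (_ : r w - p w = p w * (r w / p w - 1)); last first.
  by rewrite mulrBr mulr1 mulrC divfK ?gt_eqF.
rewrite ler_pM2l// -[r w / p w](subrKC 1) {1}[1 + _ - 1]addrC addKr.
apply: le_ln1Dx; have : 0 < r w / p w by rewrite divr_gt0.
lra.
Qed.

(** Compare p, in [gibbs], with a mixture of three weights, of order
    [expR (- b)] on Q, [expR (- a)] on S and [expR (- c)] everywhere: a point
    costs the smallest available exponent, up to the [ln 3] of the mixture. *)
Lemma entropy_grouping p (Q S : {set W}) (a b c eta : R) :
  (forall w, 0 <= p w) -> \sum_w p w = 1 ->
  0 <= a -> 0 <= c ->
  #|Q|%:R <= expR b -> #|S|%:R <= expR a -> #|W|%:R <= expR c ->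
  1 - eta <= \sum_(w in S) p w ->
  - \sum_w p w * ln (p w) <=
    ln 3 + (\sum_(w in Q) p w) * b + (1 - \sum_(w in Q) p w) * a + eta * c.
Proof.
move=> p0 p1 a0 c0 Qb Sa Wc hS.
(* A mixture of weights that are constant on Q, on S and on all of W. *)
pose r w := 3^-1 * ((w \in Q)%:R * expR (- b) + (w \in S)%:R * expR (- a)
  + expR (- c)) : R.
have sumI (A : {set W}) : \sum_w (w \in A)%:R = #|A|%:R :> R.
  rewrite -sumr_const [RHS]big_mkcond/=; apply: eq_bigr => w _.
  by case: (w \in A).
have leE (x y : R) : x <= expR y -> x * expR (- y) <= 1.
  by move=> h; rewrite expRN ler_pdivrMr ?expR_gt0// mul1r.
have tgt0 (A : {set W}) w (x : R) : 0 <= (w \in A)%:R * expR (- x).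
  by rewrite mulr_ge0// ?expR_ge0.
have r0 w : 0 < r w.
  by rewrite mulr_gt0 ?invr_gt0// ltr_wpDl ?expR_gt0// addr_ge0.
have r1 : \sum_w r w <= 1.
  rewrite -mulr_sumr !big_split/= -!mulr_suml !sumI.
  rewrite sumr_const -mulr_natl.
  have := leE _ _ Qb; have := leE _ _ Sa; have := leE _ _ Wc.
  by lra.
apply: (le_trans (gibbs p0 p1 r0 r1)).
have lnr w (x : R) : expR (- x) <= 3 * r w -> - ln (r w) <= ln 3 + x.
  move=> h; have : - x <= ln (3 * r w).
    by rewrite -[- x]expRK ler_ln ?posrE ?expR_gt0// mulr_gt0.
  by rewrite lnM ?posrE//; lra.
pose k w : R := (w \in Q)%:R * b + (w \notin Q)%:R * a + (w \notin S)%:R * c.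
have lnk w : - ln (r w) <= ln 3 + k w.
  have h3 : 3 * r w = (w \in Q)%:R * expR (- b) + (w \in S)%:R * expR (- a)
    + expR (- c) by rewrite /r mulrA divff ?mul1r.
  have eb := expR_ge0 (- b); have ea := expR_ge0 (- a); have ec := expR_ge0 (- c).
  rewrite /k; case: (boolP (w \in Q)) h3 => wQ; case: (boolP (w \in S)) => wS /= h3.
  - by rewrite mul1r mul0r mul0r !addr0; apply: lnr; rewrite h3; lra.
  - rewrite !mul1r mul0r addr0 addrA.
    apply: (@le_trans _ _ (ln 3 + b)); last lra.
    by apply: lnr; rewrite h3; lra.
  - by rewrite !mul0r mul1r add0r addr0; apply: lnr; rewrite h3; lra.
  - rewrite mul0r !mul1r add0r addrA.
    apply: (@le_trans _ _ (ln 3 + c)); last lra.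
    by apply: lnr; rewrite h3; lra.
rewrite -sumrN.
apply: (@le_trans _ _ (\sum_w p w * (ln 3 + k w))).
  by apply: ler_sum => w _; rewrite -mulrN ler_wpM2l.
rewrite /k.
have -> : \sum_w p w * (ln 3 + ((w \in Q)%:R * b + (w \notin Q)%:R * a +
    (w \notin S)%:R * c)) = ln 3 * (\sum_w p w) + (\sum_(w in Q) p w) * b +
    (1 - \sum_(w in Q) p w) * a + (1 - \sum_(w in S) p w) * c.
  transitivity (ln 3 * (\sum_w p w) + (\sum_(w in Q) p w) * b +
    (\sum_w p w - \sum_(w in Q) p w) * a + (\sum_w p w - \sum_(w in S) p w) * c);
    last by rewrite p1.
  rewrite !(big_mkcond (fun w => w \in _))/= -!sumrB.
  rewrite !(mulr_suml, mulr_sumr) -!big_split/=; apply: eq_bigr => w _.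
  by case: (w \in Q); case: (w \in S) => /=; ring.
rewrite p1 mulr1 lerD2l ler_wpM2r//; lra.
Qed.

End Gibbs.

(** * Means of bounded measurable functions *)

Section BoundedExpectation.
Local Open Scope classical_set_scope.
Local Open Scope ring_scope.
Context {d : measure_display} {Y : measurableType d} {R : realType}.
Variable mu : probability Y R.
Implicit Types (f g : Y -> R) (A : set Y).

Definition bdd_measurable f :=
  measurable_fun setT f /\ exists B : R, forall x, `|f x| <= B.

Definition pr A : R := fine (mu A).
Definition mean f : R := \int[mu]_x f x.

Lemma bdd_measurable_cst (r : R) : bdd_measurable (fun=> r).
Proof. by split; [exact: measurable_cst|exists `|r|]. Qed.

Lemma bdd_measurableD f g : bdd_measurable f -> bdd_measurable g ->
  bdd_measurable (fun x => f x + g x).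
Proof.
move=> [mf [B Bf]] [mg [C Cg]]; split; first exact: measurable_funD.
by exists (B + C) => x; rewrite (le_trans (ler_normD _ _))// lerD.
Qed.

Lemma bdd_measurableM f g : bdd_measurable f -> bdd_measurable g ->
  bdd_measurable (fun x => f x * g x).
Proof.
move=> [mf [B Bf]] [mg [C Cg]]; split; first exact: measurable_funM.
by exists (B * C) => x; rewrite normrM ler_pM.
Qed.

Lemma bdd_measurableZ (r : R) f : bdd_measurable f ->
  bdd_measurable (fun x => r * f x).
Proof. by move=> ?; apply: bdd_measurableM => //; exact: bdd_measurable_cst. Qed.

Lemma bdd_measurableB f g : bdd_measurable f -> bdd_measurable g ->
  bdd_measurable (fun x => f x - g x).
Proof.
move=> bf bg; apply: bdd_measurableD => //.
have -> : (fun x => - g x) = (fun x => -1 * g x).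
  by apply/funext => x; rewrite mulN1r.
exact: bdd_measurableZ.
Qed.

Lemma bdd_measurable_norm f : bdd_measurable f -> bdd_measurable (fun x => `|f x|).
Proof.
move=> [mf [B Bf]]; split; first exact: measurableT_comp.
by exists B => x; rewrite normr_id.
Qed.

Lemma bdd_measurable_comp f (h : Y -> Y) : measurable_fun setT h ->
  bdd_measurable f -> bdd_measurable (fun x => f (h x)).
Proof.
move=> mh [mf [B Bf]]; split; first exact: measurableT_comp.
by exists B => x.
Qed.

Lemma bdd_measurable_sum (I : Type) (s : seq I) (h : I -> Y -> R) :
  (forall i, bdd_measurable (h i)) -> bdd_measurable (fun x => \sum_(i <- s) h i x).
Proof.
move=> bh; elim: s => [|i s IH].
  under eq_fun do rewrite big_nil; exact: bdd_measurable_cst.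
by under eq_fun do rewrite big_cons; exact: bdd_measurableD.
Qed.

Lemma bdd_measurable_indic A : measurable A -> bdd_measurable \1_A.
Proof.
move=> mA; split; first exact: measurable_indic.
by exists 1 => x; rewrite indicE; case: (_ \in _); rewrite ?normr0 ?normr1.
Qed.

Lemma bdd_integrable f : bdd_measurable f -> mu.-integrable setT (EFin \o f).
Proof.
move=> [mf [B Bf]].
apply: (@le_integrable _ _ _ mu _ measurableT _ (EFin \o cst B)).
- exact/measurable_EFinP.
- by move=> x _ /=; rewrite lee_fin (le_trans (Bf x))// ler_norm.
- exact: finite_measure_integrable_cst.
Qed.

Lemma mean_ge0 f : (forall x, 0 <= f x) -> 0 <= mean f.
Proof. by move=> f0; apply: Rintegral_ge0. Qed.

Lemma mean_le f g : bdd_measurable f -> bdd_measurable g ->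
  (forall x, f x <= g x) -> mean f <= mean g.
Proof.
by move=> bf bg fg; apply: le_Rintegral => //; exact: bdd_integrable.
Qed.

Lemma meanD f g : bdd_measurable f -> bdd_measurable g ->
  mean (fun x => f x + g x) = mean f + mean g.
Proof. by move=> bf bg; apply: RintegralD => //; exact: bdd_integrable. Qed.

Lemma meanB f g : bdd_measurable f -> bdd_measurable g ->
  mean (fun x => f x - g x) = mean f - mean g.
Proof. by move=> bf bg; apply: RintegralB => //; exact: bdd_integrable. Qed.

Lemma meanZ (r : R) f : bdd_measurable f -> mean (fun x => r * f x) = r * mean f.
Proof. by move=> bf; apply: RintegralZl => //; exact: bdd_integrable. Qed.

Lemma mean_cst (r : R) : mean (fun=> r) = r.
Proof.
rewrite /mean (Rintegral_cst _ measurableT) -[RHS]mulr1.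
congr (_ * _); apply: (@EFin_inj R); rewrite fineK ?fin_num_measure//.
exact: probability_setT.
Qed.

Lemma mean_sum (I : Type) (s : seq I) (h : I -> Y -> R) :
  (forall i, bdd_measurable (h i)) ->
  mean (fun x => \sum_(i <- s) h i x) = \sum_(i <- s) mean (h i).
Proof.
move=> bh; elim: s => [|i s IH].
  by under eq_fun do rewrite big_nil; rewrite big_nil mean_cst.
under eq_fun do rewrite big_cons.
by rewrite big_cons meanD ?IH//; exact: bdd_measurable_sum.
Qed.

Lemma mean_indic A : measurable A -> mean \1_A = pr A.
Proof. by move=> mA; rewrite /mean /Rintegral integral_indic// setIT. Qed.

Lemma mean_norm f : bdd_measurable f -> `|mean f| <= mean (fun x => `|f x|).
Proof. by move=> bf; apply: le_normr_Rintegral => //; exact: bdd_integrable. Qed.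

Lemma prE A : measurable A -> (pr A)%:E = mu A.
Proof. by move=> mA; rewrite /pr fineK//; exact: fin_num_measure. Qed.

Lemma pr_ge0 A : 0 <= pr A.
Proof. by rewrite fine_ge0. Qed.

Lemma pr_le A B : measurable A -> measurable B -> A `<=` B -> pr A <= pr B.
Proof. by move=> mA mB AB; rewrite -lee_fin !prE// le_measure ?inE. Qed.

Lemma pr_le1 A : measurable A -> pr A <= 1.
Proof. by move=> mA; rewrite -lee_fin prE// probability_le1. Qed.

Lemma prC A : measurable A -> pr (~` A) = 1 - pr A.
Proof.
by move=> mA; apply/EFin_inj; rewrite EFinB !prE// ?probability_setC//; exact: measurableC.
Qed.

Lemma prU_le A B : measurable A -> measurable B -> pr (A `|` B) <= pr A + pr B.
Proof.
move=> mA mB; rewrite -lee_fin EFinD !prE//; [exact: measureU2|exact: measurableU].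
Qed.

Lemma measurable_superlevel f (t : R) :
  bdd_measurable f -> measurable [set x | t <= f x].
Proof.
move=> bf; rewrite [X in measurable X](_ : _ = setT `&` f @^-1` `[t, +oo[%classic).
  by apply: bf.1.
by apply/seteqP; split=> x /=; rewrite in_itv/= andbT // => -[].
Qed.

Lemma pr_markov f (t : R) : bdd_measurable f -> 0 < t -> (forall x, 0 <= f x) ->
  pr [set x | t <= f x] <= mean f / t.
Proof.
move=> bf t0 f0; have mS := measurable_superlevel t bf.
rewrite ler_pdivlMr// mulrC -mean_indic// -meanZ; last exact: bdd_measurable_indic.
apply: mean_le => //.
  exact/bdd_measurableZ/bdd_measurable_indic.
move=> x; rewrite indicE; case: (boolP (_ \in _)) => [|_]; last by rewrite mulr0.
by rewrite inE/= mulr1.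
Qed.

(** Completeness of L^1 for bounded functions: the upper limit v of the
    sequence is within the sum of the later increments of each term. *)
Lemma mean_fast_limit (w : nat -> Y -> R) (B : R) :
  (forall n, measurable_fun setT (w n)) -> (forall n x, `|w n x| <= B) ->
  (forall n, mean (fun x => `|w n.+1 x - w n x|) <= 2^-1 ^+ n) ->
  exists v : Y -> R, [/\ measurable_fun setT v, forall x, `|v x| <= B &
    forall n, mean (fun x => `|v x - w n x|) <= 2 * 2^-1 ^+ n].
Proof.
move=> mw wB dw.
have ub x : has_ubound (range (w ^~ x)).
  by exists B => _ [n _ <-]; rewrite (le_trans (ler_norm _)).
have lb x : has_lbound (range (w ^~ x)).
  by exists (- B) => _ [n _ <-]; move: (wB n x); rewrite ler_norml => /andP[].
pose v x := limn_sup (w ^~ x).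
have vE x : v x = inf (range (sups (w ^~ x))).
  by apply/cvg_lim => //; exact: cvg_sups_inf.
have lbs x : has_lbound (range (sups (w ^~ x))).
  exists (- B) => _ [n _ <-]; rewrite (@le_trans _ _ (w n x))//.
    by move: (wB n x); rewrite ler_norml => /andP[].
  by apply: ub_le_sup; [exact/has_ubound_sdrop|exists n => /=].
have vw x k (c s : R) : (forall j, (k <= j)%N -> `|w j x - c| <= s) -> `|v x - c| <= s.
  move=> h; rewrite ler_distl vE; apply/andP; split.
    apply: lb_le_inf; first by exists (sups (w ^~ x) 0%N), 0%N.
    move=> _ [n _ <-]; apply: (@le_trans _ _ (w (maxn k n) x)).
      by have := h _ (leq_maxl k n); rewrite ler_distl => /andP[].
    apply: ub_le_sup; first exact/has_ubound_sdrop.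
    by exists (maxn k n) => //=; rewrite leq_maxr.
  apply: (@le_trans _ _ (sups (w ^~ x) k)).
    by apply: ge_inf; [exact: lbs|exists k].
  apply: ge_sup; first by exists (w k x), k => /=.
  by move=> _ [j /= kj <-]; have := h _ kj; rewrite ler_distl => /andP[].
have mv : measurable_fun setT v.
  exact: measurable_fun_limn_sup.
have vB x : `|v x| <= B.
  by rewrite -[v x]subr0; apply: (vw _ 0%N) => j _; rewrite subr0.
have bw n : bdd_measurable (w n) by split => //; exists B.
have bv : bdd_measurable v by split => //; exists B.
exists v; split => // n.
pose D i x : \bar R := `|w (n + i).+1 x - w (n + i)%N x|%:E.
have mD i : measurable_fun setT (D i).
  by apply/measurable_EFinP; apply: (bdd_measurable_norm (bdd_measurableB (bw _) (bw _))).1.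
have key x : (`|v x - w n x|%:E <= \sum_(i <oo) D i x)%E.
  have D0 i : (0 <= i)%N -> true -> (0 <= D i x)%E by rewrite lee_fin.
  case S : (\sum_(i <oo) D i x)%E => [s| |]; last 2 first.
  - by rewrite leey.
  - by have := nneseries_ge0 D0; rewrite S.
  rewrite lee_fin; apply: (vw _ n) => j nj.
  rewrite -lee_fin -S -(subnKC nj).
  apply: (@le_trans _ _ (\sum_(0 <= i < (j - n)%N) D i x)%E); last first.
    by apply: nneseries_lim_ge => i _; exact: D0.
  elim: (j - n)%N => [|m IH].
    by rewrite addn0 subrr normr0 big_geq.
  rewrite big_nat_recr//= addnS (le_trans _ (leeD2r _ IH))//.
  rewrite -EFinD lee_fin.
  rewrite (_ : _ - _ = (w (n + m)%N x - w n x) + (w (n + m).+1 x - w (n + m)%N x)).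
    exact: ler_normD.
  by ring.
have bd : bdd_measurable (fun x => `|v x - w n x|).
  exact/bdd_measurable_norm/bdd_measurableB.
have meanE f : bdd_measurable f -> (mean f)%:E = (\int[mu]_x (f x)%:E)%E.
  move=> bf; rewrite /mean /Rintegral fineK//.
  exact: integrable_fin_num (bdd_integrable bf).
rewrite -lee_fin meanE//.
apply: (@le_trans _ _ (\int[mu]_x \sum_(i <oo) D i x)%E).
  apply: ge0_le_integral => //.
  - by apply/measurable_EFinP; exact: bd.1.
  - by apply: ge0_emeasurable_sum => [k x _ _|k _]; [rewrite lee_fin|exact: mD].
rewrite integral_nneseries//; last by move=> i x _; rewrite lee_fin.
apply: lime_le.
  by apply: is_cvg_nneseries => i _ _; apply: integral_ge0 => x _; rewrite lee_fin.
apply: nearW => m.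
apply: (@le_trans _ _ (\sum_(0 <= i < m) (2^-1 ^+ (n + i))%:E)%E).
  apply: lee_sum => i _.
  rewrite -meanE ?lee_fin//; exact/bdd_measurable_norm/bdd_measurableB.
rewrite sumEFin lee_fin.
have -> : \sum_(0 <= i < m) 2^-1 ^+ (n + i) = 2 * 2^-1 ^+ n - 2 * 2^-1 ^+ (n + m) :> R.
  elim: m => [|m IH]; first by rewrite big_geq// addn0 subrr.
  by rewrite big_nat_recr//= IH addnS exprS; field.
by rewrite gerBl mulr_ge0// exprn_ge0// invr_ge0.
Qed.

Lemma pr_decreasing_small (A : nat -> set Y) (e : R) :
  (forall n, measurable (A n)) -> (forall n, A n.+1 `<=` A n) ->
  \bigcap_n A n = set0 -> 0 < e -> exists n, pr (A n) <= e.
Proof.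
move=> mA dA A0 e0.
have niA : nonincreasing_seq A.
  by apply/nonincreasing_seqP => n; apply/subsetPset; exact: dA.
have := @nonincreasing_cvg_mu _ _ _ mu A _ mA _ niA.
rewrite A0 measure0 => /(_ _ (@measurable0 _ _)) h.
have /h : (mu (A 0%N) < +oo)%E by rewrite -ge0_fin_numE// fin_num_measure.
move=> /fine_cvgP[_ /cvgrPdist_le/(_ _ e0)[n _ /(_ n (leqnn n))]] /=.
rewrite sub0r normrN => h2; exists n; apply: le_trans h2; exact: ler_norm.
Qed.

End BoundedExpectation.

(** * The mean ergodic theorem *)

Section FolnerSums.
Context {R : realType} {G : groupType}.
Local Open Scope fset_scope.

(** The common part of the two sums cancels. *)
Lemma dist_sum_symdiff (A B : {fset G}) (a : G -> R) (C : R) :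
  (forall g, `|a g| <= C) ->
  `|\sum_(g <- A) a g - \sum_(g <- B) a g| <= C * #|` symdiff A B|%:R.
Proof.
move=> aC.
rewrite (big_fsetID _ (mem B) A)/= [X in _ - X](big_fsetID _ (mem A) B)/=.
have -> : [fset x in B | x \in A] = [fset x in A | x \in B].
  by apply/fsetP => x; rewrite !inE andbC.
rewrite opprD addrACA subrr add0r.
apply: (@le_trans _ _ (\sum_(g <- symdiff A B) `|a g|)); last first.
  apply: (@le_trans _ _ (\sum_(g <- symdiff A B) C)); first exact: ler_sum.
  by rewrite big_const_seq count_predT iter_addr_0 mulr_natr.
rewrite (big_fsetID _ (mem A) (symdiff A B))/=.
have -> : [fset x in symdiff A B | x \in A] = [fset x in A | x \notin B].
  by apply/fsetP => x; rewrite !inE; case: (x \in A); case: (x \in B).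
have -> : [fset x in symdiff A B | x \notin A] = [fset x in B | x \notin A].
  by apply/fsetP => x; rewrite !inE; case: (x \in A); case: (x \in B).
by rewrite (le_trans (ler_normB _ _))// lerD// ler_norm_sum.
Qed.

Lemma sum_translate (h : G) (A : {fset G}) (a : G -> R) :
  \sum_(g <- translate h A) a g = \sum_(g <- A) a (h * g)%g.
Proof. by rewrite /translate big_imfset//= => x y _ _ /mulgI. Qed.

End FolnerSums.

Section MeanErgodic.
Local Open Scope classical_set_scope.
Local Open Scope ring_scope.
Context {d : measure_display} {Y : measurableType d} {R : realType}.
Variable mu : probability Y R.
Context {G : groupType} (act : G -> Y -> Y).
Hypothesis actM : forall g h x, act (g * h)%g x = act g (act h x).
Hypothesis mact : forall g, measurable_fun setT (act g).
Hypothesis inv : forall g (A : set Y), measurable A -> mu (act g @^-1` A) = mu A.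
Implicit Types (f : Y -> R) (s : seq G).

Lemma bdd_measurable_act f g : bdd_measurable f ->
  bdd_measurable (fun x => f (act g x)).
Proof. exact: bdd_measurable_comp. Qed.

Lemma bdd_measurable_sqr f : bdd_measurable f ->
  bdd_measurable (fun x => f x ^+ 2).
Proof. by move=> bf; under eq_fun do rewrite expr2; exact: bdd_measurableM. Qed.

Lemma mean_act f g : bdd_measurable f -> mean mu (fun x => f (act g x)) = mean mu f.
Proof.
move=> bf; rewrite /mean /Rintegral; congr fine.
have mf : measurable_fun setT (EFin \o f) by apply/measurable_EFinP; exact: bf.1.
have := @integral_pushforward _ _ _ _ _ _ (mact g) mu setT _ mf
  (bdd_integrable mu (bdd_measurable_act g bf)) measurableT.
rewrite preimage_setT /= => <-; apply: eq_measure_integral => A mA _.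
exact: inv.
Qed.

Definition avg s f x : R := (\sum_(g <- s) f (act g x)) / (size s)%:R.

Lemma bdd_measurable_avg s f : bdd_measurable f -> bdd_measurable (avg s f).
Proof.
move=> bf; rewrite /avg; apply: bdd_measurableM; last exact: bdd_measurable_cst.
by apply: bdd_measurable_sum => g; exact: bdd_measurable_act.
Qed.

Lemma mean_avg s f : s != [::] -> bdd_measurable f -> mean mu (avg s f) = mean mu f.
Proof.
move=> s0 bf; rewrite /avg.
have bs g : bdd_measurable (fun x => f (act g x)) by exact: bdd_measurable_act.
under eq_fun do rewrite mulrC.
rewrite meanZ; last exact: bdd_measurable_sum.
rewrite mean_sum//; under eq_bigr do rewrite mean_act//.
rewrite big_const_seq count_predT iter_addr_0 -[X in _ * X]mulr_natl mulKf//.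
by rewrite pnatr_eq0 size_eq0.
Qed.

Lemma avg_norm s f x : `|avg s f x| <= avg s (fun y => `|f y|) x.
Proof.
by rewrite /avg normrM [X in _ * X]ger0_norm ?invr_ge0// ler_wpM2r ?invr_ge0// ler_norm_sum.
Qed.

Lemma avg_bound s f B x : s != [::] -> (forall y, `|f y| <= B) -> `|avg s f x| <= B.
Proof.
move=> s0 fB; have n0 : 0 < (size s)%:R :> R by rewrite ltr0n lt0n size_eq0.
rewrite (le_trans (avg_norm _ _ _))// /avg ler_pdivrMr//.
rewrite mulr_natr -[leRHS]iter_addr_0 -(count_predT s) -big_const_seq.
exact: ler_sum.
Qed.

Lemma avg_cst s (c : R) x : s != [::] -> avg s (fun=> c) x = c.
Proof.
move=> s0; rewrite /avg big_const_seq count_predT iter_addr_0 -[X in X / _]mulr_natr mulfK//.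
by rewrite pnatr_eq0 size_eq0.
Qed.

Lemma avgB s f1 f2 x : avg s (fun y => f1 y - f2 y) x = avg s f1 x - avg s f2 x.
Proof. by rewrite /avg sumrB mulrBl. Qed.

Lemma avgZ s (c : R) f x : avg s (fun y => c * f y) x = c * avg s f x.
Proof. by rewrite /avg -mulr_sumr mulrA. Qed.

Lemma avgD s f1 f2 x : avg s (fun y => f1 y + f2 y) x = avg s f1 x + avg s f2 x.
Proof. by rewrite /avg big_split/= mulrDl. Qed.

Lemma avg_sum s (I : Type) (r : seq I) (h : I -> Y -> R) x :
  avg s (fun y => \sum_(i <- r) h i y) x = \sum_(i <- r) avg s (h i) x.
Proof. by rewrite /avg exchange_big/= mulr_suml. Qed.

Lemma avg_sqr_le s f x : avg s f x ^+ 2 <= avg s (fun y => f y ^+ 2) x.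
Proof.
have [->|s0] := eqVneq s [::]; first by rewrite /avg !big_nil !mul0r expr0n.
set a := avg s f x.
suff : 0 <= avg s (fun y => (f y - a) ^+ 2) x.
  have -> : (fun y => (f y - a) ^+ 2) = (fun y => f y ^+ 2 - (2 * a * f y - a ^+ 2)).
    by apply/funext => y; ring.
  rewrite avgB (avgB s (fun y => 2 * a * f y)) avgZ avg_cst// -/a; lra.
by rewrite /avg mulr_ge0 ?invr_ge0// sumr_ge0// => g _; exact: sqr_ge0.
Qed.

Lemma avg_act s f h x :
  avg s f (act h x) = avg [seq (g * h)%g | g <- s] f x.
Proof.
by rewrite /avg size_map big_map; under [in RHS]eq_bigr do rewrite actM.
Qed.

Variable F : nat -> {fset G}.
Hypothesis Ffol : Folner R F.

Let F0 N : enum_fset (F N) != [::].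
Proof.
apply: contraNneq (Ffol.1 N) => FN; rewrite -cardfs_eq0.
by rewrite /= FN.
Qed.

(** The averages of psi along the sequence inherit the asymptotics of those of
    f. All the finite averages of translates of f have this property; it thus
    plays the role of membership in their convex hull. *)
Definition coaveraging f psi := forall e : R, 0 < e -> exists N0 : nat,
  forall N x, (N0 <= N)%N -> `|avg (F N) psi x - avg (F N) f x| <= e.

(** Averaging a translate over F N amounts to averaging f over a left
    translate of F N, which is almost the same set. *)
Lemma coaveraging_act f h : bdd_measurable f ->
  coaveraging f (fun x => f (act h x)).
Proof.
move=> [_ [B fB]] e e0.
have B0 : 0 < `|B| + 1 by rewrite ltr_pwDr.
have /cvgrPdist_le/(_ (e / (`|B| + 1))) := Ffol.2 h.
have eB : 0 < e / (`|B| + 1) by rewrite divr_gt0.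
move=> /(_ eB)[N0 _ hN0]; exists N0 => N x /hN0/=.
rewrite sub0r normrN => hN.
rewrite /avg -mulrBl normrM.
under eq_bigr do rewrite -actM.
rewrite -(sum_translate h (F N) (fun g => f (act g x))).
have /le_trans h1 := @dist_sum_symdiff R G (translate h (F N)) (F N)
  (fun g => f (act g x)) (`|B| + 1)
  (fun g => le_trans (fB _) (ler_wpDr ler01 (ler_norm B))).
have -> : e = (`|B| + 1) * (e / (`|B| + 1)) by rewrite mulrC divfK ?gt_eqF.
apply: (@le_trans _ _ ((`|B| + 1) * (#|` symdiff (F N) (translate h (F N))|%:R / #|` F N|%:R))).
  rewrite mulrA normfV [X in _ / X]ger0_norm ?ler0n//; apply: ler_wpM2r; first by rewrite invr_ge0.
  by apply: h1; rewrite /symdiff fsetUC.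
rewrite ler_wpM2l ?(ltW B0)//; exact: le_trans (ler_norm _) hN.
Qed.

Lemma coaveraging_avg f s : bdd_measurable f -> s != [::] ->
  coaveraging f (avg s f).
Proof.
move=> bf s0.
have hs e : 0 < e -> exists N0 : nat, forall N x, (N0 <= N)%N ->
    `|\sum_(h <- s) avg (F N) (fun y => f (act h y)) x
      - (size s)%:R * avg (F N) f x| <= (size s)%:R * e.
  move=> e0; elim: s {s0} => [|h s [N0 IH]].
    by exists 0%N => N x _; rewrite big_nil/= !mul0r subrr normr0.
  have [N1 hN1] := coaveraging_act h bf e0.
  exists (maxn N0 N1) => N x; rewrite geq_max => /andP[/(IH _ x) hs /(hN1 _ x) hh].
  rewrite big_cons/= -natr1 !mulrDl !mul1r.
  rewrite (_ : _ - _ = (\sum_(j <- s) avg (F N) (fun y => f (act j y)) x -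
    (size s)%:R * avg (F N) f x) + (avg (F N) (fun y => f (act h y)) x - avg (F N) f x)).
    by rewrite (le_trans (ler_normD _ _))// lerD.
  by ring.
move=> e e0; have [N0 hN0] := hs _ e0; exists N0 => N x /(hN0 _ x).
have n0 : 0 < (size s)%:R :> R by rewrite ltr0n lt0n size_eq0.
have -> : avg (F N) (avg s f) x =
    (\sum_(h <- s) avg (F N) (fun y => f (act h y)) x) / (size s)%:R.
  by rewrite -avg_sum mulrC -avgZ; congr avg; apply/funext => y; rewrite mulrC.
move=> h; rewrite -(ler_pM2l n0); apply: le_trans h.
rewrite -[X in X * _ <= _]ger0_norm ?ler0n// -normrM mulrBr.
by rewrite [X in `|X - _| <= _]mulrC divfK ?gt_eqF.
Qed.

Lemma coaveraging_half f g h : coaveraging f g -> coaveraging f h ->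
  coaveraging f (fun x => 2^-1 * (g x + h x)).
Proof.
move=> cg ch e e0; have [N1 h1] := cg e e0; have [N2 h2] := ch e e0.
exists (maxn N1 N2) => N x; rewrite geq_max => /andP[/(h1 _ x) a /(h2 _ x) b].
rewrite avgZ avgD ler_distl; move: a b; rewrite !ler_distl.
by move=> /andP[? ?] /andP[? ?]; apply/andP; split; lra.
Qed.

Lemma mean_sqr_avg_le s f : s != [::] -> bdd_measurable f ->
  mean mu (fun x => avg s f x ^+ 2) <= mean mu (fun x => f x ^+ 2).
Proof.
move=> s0 bf; have bf2 := bdd_measurable_sqr bf.
rewrite -(mean_avg s0 bf2); apply: mean_le; last by move=> x; exact: avg_sqr_le.
  exact/bdd_measurable_sqr/bdd_measurable_avg.
exact: bdd_measurable_avg.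
Qed.

Let energy f N := mean mu (fun x => avg (F N) f x ^+ 2).

(** Averaging does not increase the second moment, by convexity and invariance. *)
Lemma coaveraging_energy f psi : bdd_measurable f -> bdd_measurable psi ->
  coaveraging f psi -> forall e : R, 0 < e -> exists N0 : nat, forall N,
  (N0 <= N)%N -> energy f N <= mean mu (fun x => psi x ^+ 2) + e.
Proof.
move=> bf bpsi cpsi e e0.
have [B [B0 fB pB]] : exists B, [/\ 0 < B, forall x, `|f x| <= B & forall x, `|psi x| <= B].
  have [[_ [B1 h1]] [_ [B2 h2]]] := (bf, bpsi).
  exists (`|B1| + `|B2| + 1); split => [|x|x].
  - by rewrite ltr_wpDl// addr_ge0.
  - rewrite (le_trans (h1 x))// -addrA (le_trans (ler_norm _))// lerDl addr_ge0//.
  - rewrite (le_trans (h2 x))// (le_trans (ler_norm _))// addrAC lerDr addr_ge0//.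
have eB : 0 < e / (2 * B) by rewrite divr_gt0// mulr_gt0.
have [N0 hN0] := cpsi _ eB; exists N0 => N /hN0 h.
apply: (@le_trans _ _ (mean mu (fun x => avg (F N) psi x ^+ 2) + e)); last first.
  by rewrite lerD2r; exact: mean_sqr_avg_le.
rewrite -[X in _ + X](mean_cst mu) -meanD; last 2 first.
- exact/bdd_measurable_sqr/bdd_measurable_avg.
- exact: bdd_measurable_cst.
apply: mean_le.
- exact/bdd_measurable_sqr/bdd_measurable_avg.
- apply: bdd_measurableD; last exact: bdd_measurable_cst.
  exact/bdd_measurable_sqr/bdd_measurable_avg.
move=> x; have := h x; set a := avg _ psi x; set b := avg _ f x => ab.
rewrite -lerBlDl subr_sqr.
apply: (le_trans (ler_norm _)); rewrite normrM.
have -> : e = (e / (2 * B)) * (2 * B) by rewrite divfK// gt_eqF// mulr_gt0.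
apply: ler_pM => //; first by rewrite distrC.
rewrite (le_trans (ler_normD _ _))// mulr2n mulrDl mul1r lerD// avg_bound//.
Qed.

(** The infimum m of the energies is their limit, because the energy of every
    average of translates bounds the later energies from above, up to
    arbitrarily small errors ([coaveraging_energy]); for the same reason no
    such average has a second moment below m. *)
Lemma energy_floor f : bdd_measurable f -> exists m : R,
  (forall psi, bdd_measurable psi -> coaveraging f psi ->
     m <= mean mu (fun x => psi x ^+ 2)) /\
  (forall e, 0 < e -> exists N0 : nat, forall N, (N0 <= N)%N -> energy f N <= m + e).
Proof.
move=> bf; pose E := range (energy f).
have lbE : has_lbound E.
  by exists 0 => _ [N _ <-]; apply: mean_ge0 => x; exact: sqr_ge0.
have infE : has_inf E by split => //; exists (energy f 0%N), 0%N.
exists (inf E); split => [psi bpsi cpsi|e e0].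
  apply/ler_addgt0Pr => e e0.
  have [N hN] := coaveraging_energy bf bpsi cpsi e0.
  by rewrite (le_trans _ (hN N _))//; apply: ge_inf => //; exists N.
have e2 : 0 < e / 2 by rewrite divr_gt0.
have [_ [n _ <-] hn] := inf_adherent e2 infE.
have [N0 hN0] := coaveraging_energy bf (bdd_measurable_avg (F n) bf)
  (coaveraging_avg bf (F0 n)) e2.
exists N0 => N /hN0 hN.
by apply: (le_trans hN); move: hn; rewrite /energy; lra.
Qed.

Lemma mean_norm_le f e : bdd_measurable f -> 0 < e ->
  mean mu (fun x => f x ^+ 2) <= e ^+ 2 -> mean mu (fun x => `|f x|) <= e.
Proof.
move=> bf e0 h.
have sq := bdd_measurable_sqr bf.
apply: (@le_trans _ _ (mean mu (fun x => (2 * e)^-1 * f x ^+ 2 + e / 2))).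
  apply: mean_le; first exact: bdd_measurable_norm.
    by apply: bdd_measurableD; [exact: bdd_measurableZ|exact: bdd_measurable_cst].
  move=> x; rewrite -real_normK ?num_real//; set a := `|f x|.
  have -> : (2 * e)^-1 * a ^+ 2 + e / 2 = a + (2 * e)^-1 * (a - e) ^+ 2.
    by field; rewrite gt_eqF.
  by rewrite lerDl mulr_ge0 ?sqr_ge0// invr_ge0 mulr_ge0// ltW.
rewrite meanD; [|exact: bdd_measurableZ|exact: bdd_measurable_cst].
rewrite mean_cst meanZ//.
have e2 : (2 * e)^-1 * e ^+ 2 + e / 2 = e by field; rewrite gt_eqF.
rewrite -[leRHS]e2 lerD2r; apply: ler_wpM2l h.
by rewrite invr_ge0 mulr_ge0// ltW.
Qed.

(** The parallelogram identity. *)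
Lemma sum_sqr_dist g h : bdd_measurable g -> bdd_measurable h ->
  mean mu (fun x => (g x - h x) ^+ 2) =
  2 * mean mu (fun x => g x ^+ 2) + 2 * mean mu (fun x => h x ^+ 2)
  - 4 * mean mu (fun x => (2^-1 * (g x + h x)) ^+ 2).
Proof.
move=> bg bh.
have bm := bdd_measurableZ 2^-1 (bdd_measurableD bg bh).
rewrite -(meanZ mu 2 (bdd_measurable_sqr bg)) -(meanZ mu 2 (bdd_measurable_sqr bh)) -(meanZ mu 4 (bdd_measurable_sqr bm)).
have b1 := bdd_measurableZ 2 (bdd_measurable_sqr bg); have b2 := bdd_measurableZ 2 (bdd_measurable_sqr bh).
rewrite -(meanD mu b1 b2) -meanB; last 2 first.
- exact: bdd_measurableD.
- exact/bdd_measurableZ/bdd_measurable_sqr.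
by congr mean; apply/funext => x; field.
Qed.

(** By the parallelogram identity, two averages whose energies are close to the
    floor are close to each other, since their half-sum is not below the floor.
    The same holds for an average and its translate. *)
Lemma avg_cauchy f : bdd_measurable f -> forall e : R, 0 < e -> exists N0 : nat,
  (forall N M, (N0 <= N)%N -> (N0 <= M)%N ->
    mean mu (fun x => `|avg (F N) f x - avg (F M) f x|) <= e) /\
  (forall N h, (N0 <= N)%N ->
    mean mu (fun x => `|avg (F N) f (act h x) - avg (F N) f x|) <= e).
Proof.
move=> bf e e0; have [m [hm /(_ (e ^+ 2 / 4))[]]] := energy_floor bf.
  by rewrite divr_gt0// exprn_gt0.
move=> N0 hN0; have ba N := bdd_measurable_avg (F N) bf.
have ca N := coaveraging_avg bf (F0 N).
exists N0; split => [N M /hN0 hN /hN0 hM|N h /hN0 hN].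
  apply: mean_norm_le => //; first exact: bdd_measurableB.
  rewrite sum_sqr_dist//.
  have := hm _ _ (coaveraging_half (ca N) (ca M)).
  move=> /(_ (bdd_measurableZ _ (bdd_measurableD (ba _) (ba _)))).
  by move: hN hM; rewrite /energy; lra.
have bah := bdd_measurable_act h (ba N).
apply: mean_norm_le => //; first exact: bdd_measurableB.
rewrite sum_sqr_dist//.
have cah : coaveraging f (fun x => avg (F N) f (act h x)).
  under eq_fun do rewrite avg_act.
  by apply: coaveraging_avg => //; rewrite -size_eq0 size_map size_eq0.
have := hm _ (bdd_measurableZ _ (bdd_measurableD bah (ba _))) (coaveraging_half cah (ca N)).
have -> : mean mu (fun x => avg (F N) f (act h x) ^+ 2) = energy f N.
  apply: (mean_act h (f := fun x => avg (F N) f x ^+ 2)).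
  exact: bdd_measurable_sqr.
by move: hN; rewrite /energy; lra.
Qed.

Hypothesis act1 : forall x, act 1%g x = x.
Hypothesis Gcount : countable [set: G].
Hypothesis erg : forall A : set Y, measurable A ->
  (forall g, act g @^-1` A = A) -> mu A = 0%E \/ mu A = 1%E.

(** Every superlevel set of v has measure 0 or 1. Those above the mean cannot
    have measure 1, so the positive part of v - mean v vanishes almost
    everywhere, and then so does v - mean v, as its mean is 0. *)
Lemma ergodic_const (v : Y -> R) : bdd_measurable v ->
  (forall h, mean mu (fun x => `|v (act h x) - v x|) = 0) ->
  mean mu (fun x => `|v x - mean mu v|) = 0.
Proof.
move=> bv vinv; set c := mean mu v.
have [j jinj] : exists j : G -> nat, injective j.
  have /countable_injP[j jinj] := Gcount.
  by exists j => x y; apply: jinj; rewrite inE.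
pose e n : G := xget 1%g [set g | j g = n].
have eK g : e (j g) = g.
  rewrite /e; apply: xget_unique => //= h /= hg; exact: jinj.
have bvh h : bdd_measurable (fun x => v (act h x)) by exact: bdd_measurable_act.
have mA t : measurable [set x | t < v x].
  rewrite [X in measurable X](_ : _ = setT `&` v @^-1` `]t, +oo[%classic).
    by apply: bv.1.
  by apply/seteqP; split=> x /=; rewrite in_itv/= andbT // => -[].
have mean_null (k : Y -> R) A : measurable A -> mu A = 0%E -> bdd_measurable k ->
    (forall x, 0 <= k x) -> mean mu (fun x => k x * \1_A x) = 0.
  move=> mA' A0 [mk [B kB]] k0.
  have bi : bdd_measurable (\1_A : Y -> R) by exact: bdd_measurable_indic.
  apply/eqP; rewrite eq_le; apply/andP; split; last first.
    by apply: mean_ge0 => x; rewrite mulr_ge0.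
  apply: (@le_trans _ _ (mean mu (fun x => B * \1_A x))).
    apply: mean_le; first by apply: bdd_measurableM => //; split=> //; exists B.
      exact: bdd_measurableZ.
    by move=> x; rewrite ler_wpM2r// (le_trans (ler_norm _)).
  by rewrite meanZ// mean_indic// /pr A0 /= mulr0.
(* The set of points whose whole orbit lies in the superlevel set differs from
   it by a null set, G being countable, and is invariant. *)
have zero_one t : mu [set x | t < v x] = 0%E \/ mu [set x | t < v x] = 1%E.
  pose A := [set x | t < v x].
  pose A' := \bigcap_n (act (e n) @^-1` A).
  have A'E x : A' x <-> forall g, A (act g x).
    split => [h g|h n _]; last exact: h.
    by rewrite -(eK g); exact: h.
  have mA' : measurable A'.
    apply: bigcapT_measurable => n; rewrite -[X in measurable X]setTI.
    by apply: mact => //; exact: mA.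
  have A'inv g : act g @^-1` A' = A'.
    apply/seteqP; split => x /A'E h; apply/A'E => k.
      by have := h (k * g^-1)%g; rewrite -actM -mulgA mulVg mulg1.
    by rewrite -actM; exact: h.
  suff -> : mu A = mu A' by exact: erg.
  pose N := \bigcup_n [set x | v (act (e n) x) != v x].
  have mvh n : measurable [set x | v (act (e n) x) != v x].
    rewrite [X in measurable X](_ : _ = setT `&`
      (fun x => v (act (e n) x) - v x) @^-1` (~` [set 0])).
      by apply: (bdd_measurableB (bvh _) bv).1 => //; exact: measurableC.
    apply/seteqP; split=> x /= => [ne|[_ /eqP]]; last by rewrite subr_eq0.
    by split=> //; apply/eqP; rewrite subr_eq0.
  have mN : measurable N by exact: bigcupT_measurable.
  have N0 : mu N = 0%E.
    apply: (proj1 (negligibleP mu mN) _); apply: negligible_bigcup => n.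
    have bd := bdd_measurableB (bvh (e n)) bv.
    have mw : measurable_fun setT (EFin \o (fun x => v (act (e n) x) - v x)).
      by apply/measurable_EFinP; exact: bd.1.
    have : (\int[mu]_x `|(v (act (e n) x) - v x)%:E|)%E = 0%E.
      have bn := bdd_measurable_norm bd.
      rewrite -[LHS](@fineK R); last exact: (integrable_fin_num measurableT (bdd_integrable mu bn)).
      by congr EFin; exact: vinv.
    move/(ae_eq_integral_abs mu measurableT mw); apply: negligibleS => x /=.
    by move=> ne h; move: (h I) => -[] /eqP; rewrite subr_eq0 (negPf ne).
  have AN : A `<=` A' `|` N.
    move=> x Ax; have [Nx|nNx] := pselect (N x); [by right|left].
    move=> n _; rewrite /A/=; have [->//|ne] := eqVneq (v (act (e n) x)) (v x).
    by case: nNx; exists n.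
  have A'A : A' `<=` A by move=> x /A'E /(_ 1%g); rewrite act1.
  apply/eqP; rewrite eq_le; apply/andP; split; last first.
    by apply: le_measure; rewrite ?inE//; exact: mA.
  apply: (@le_trans _ _ (mu (A' `|` N))).
    by apply: le_measure; rewrite ?inE//; [exact: mA|exact: measurableU].
  by rewrite -[leRHS]adde0 -N0; exact: measureU2.
have bw := bdd_measurableB bv (bdd_measurable_cst c).
have bn := bdd_measurable_norm bw.
have w0 : mean mu (fun x => v x - c) = 0.
  by rewrite meanB ?mean_cst ?subrr//; exact: bdd_measurable_cst.
apply/eqP; rewrite eq_le mean_ge0// andbT; apply/ler_addgt0Pr => eta eta0.
rewrite add0r.
pose A := [set x | c + eta / 2 < v x].
have mA2 : measurable A by exact: mA.
have bi B : measurable B -> bdd_measurable (\1_B : Y -> R) by exact: bdd_measurable_indic.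
have [A0|A1] := zero_one (c + eta / 2); last first.
  have mAC : measurable (~` A) by exact: measurableC.
  have prA : pr mu A = 1 by apply/(@EFin_inj R); rewrite prE.
  have AC0 : mu (~` A) = 0%E.
    by transitivity ((pr mu (~` A))%:E); rewrite ?prE// -prE// prC// prA subrr.
  have : mean mu (fun x => eta / 2 - `|v x - c - eta / 2| * \1_(~` A) x) <= 0.
    rewrite -w0; apply: mean_le => //.
      apply: bdd_measurableB; first exact: bdd_measurable_cst.
      apply: bdd_measurableM; last exact: bi.
      by apply: bdd_measurable_norm; apply: bdd_measurableB => //; exact: bdd_measurable_cst.
    move=> x; rewrite indicE; case: (boolP (x \in ~` A)) => [_|].
      by rewrite mulr1; have := ler_norm (- (v x - c - eta / 2)); rewrite normrN; lra.
    by rewrite notin_setE /= => /contrapT; rewrite /A /= mulr0; lra.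
  have bk : bdd_measurable (fun x => `|v x - c - eta / 2|).
    by apply: bdd_measurable_norm; apply: bdd_measurableB => //; exact: bdd_measurable_cst.
  rewrite meanB; last 2 first.
  - exact: bdd_measurable_cst.
  - by apply: bdd_measurableM => //; exact: bi.
  by rewrite mean_cst mean_null//; lra.
apply: (@le_trans _ _ (mean mu (fun x => eta + 2 * (`|v x - c| * \1_A x) - (v x - c)))).
  have bni : bdd_measurable (fun x => `|v x - c| * \1_A x).
    by apply: bdd_measurableM => //; exact: bi.
  apply: mean_le => //.
    apply: bdd_measurableB => //; apply: bdd_measurableD; first exact: bdd_measurable_cst.
    exact: bdd_measurableZ.
  move=> x; rewrite indicE; case: (boolP (x \in A)) => [|].
    by rewrite inE /A/= => h; rewrite ger0_norm; lra.
  rewrite notin_setE /A/= => /negP; rewrite -leNgt => h.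
  by rewrite mulr0; case: (ler0P (v x - c)); lra.
have bni : bdd_measurable (fun x => `|v x - c| * \1_A x).
  by apply: bdd_measurableM => //; exact: bi.
have b2 := bdd_measurableZ 2 bni.
rewrite meanB//; last by apply: bdd_measurableD => //; exact: bdd_measurable_cst.
rewrite (meanD mu (bdd_measurable_cst eta) b2).
by rewrite (meanZ mu 2 bni) mean_null// w0 mean_cst; lra.
Qed.

Lemma exists_half_expr_le (e : R) : 0 < e -> exists k, 2^-1 ^+ k <= e.
Proof.
move=> e0; exists (Num.bound e^-1).
rewrite exprVn -[leRHS]invrK lef_pV2 ?posrE ?exprn_gt0 ?invr_gt0//.
by rewrite ltW// upper_nthrootP.
Qed.

(** The averages converge in L^1: along a sparse subsequence they are summably
    Cauchy, so they have a limit, which is invariant, hence constant; and the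
    averages of the averages stay close to those of f. *)
Theorem mean_ergodic f : bdd_measurable f -> forall e : R, 0 < e ->
  exists N0 : nat, forall N, (N0 <= N)%N ->
    mean mu (fun x => `|avg (F N) f x - mean mu f|) <= e.
Proof.
move=> bf; have ba N := bdd_measurable_avg (F N) bf.
have half0 k : 0 < 2^-1 ^+ k :> R by rewrite exprn_gt0// invr_gt0.
have [n hn] := choice (fun k => avg_cauchy bf (half0 k)).
(* Partial sums make the subsequence monotone and above both thresholds. *)
pose r k := (\sum_(i < k.+1) n i)%N.
have nr k : (n k <= r k)%N by rewrite /r big_ord_recr/= leq_addl.
have nrS k : (n k <= r k.+1)%N.
  by rewrite (leq_trans (nr k))// /r [in leqRHS]big_ord_recr/= leq_addr.
have [B fB] := bf.2.
have [v [mv vB hv]] := @mean_fast_limit _ _ _ mu (fun k => avg (F (r k)) f) B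
  (fun k => (ba _).1) (fun k x => avg_bound x (F0 _) fB)
  (fun k => (hn k).1 _ _ (nrS k) (nr k)).
have bv : bdd_measurable v by split => //; exists B.
have bd k := bdd_measurableB bv (ba (r k)).
have small (x : R) : 0 <= x -> (forall k, x <= 8 * 2^-1 ^+ k) -> x = 0.
  move=> x0 hx; apply/eqP; rewrite eq_le x0 andbT; apply/ler_addgt0Pr => e e0.
  have [|k hk] := @exists_half_expr_le (e / 8); first by rewrite divr_gt0.
  by have := hx k; lra.
have vE : mean mu v = mean mu f.
  apply/eqP; rewrite -subr_eq0 -normr_eq0; apply/eqP; apply: small => // k.
  rewrite -(mean_avg (F0 (r k)) bf) -meanB// (le_trans (mean_norm mu (bd k)))//.
  by rewrite (le_trans (hv k))// ler_wpM2r ?(ltW (half0 k))// ler_nat.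
have vinv h : mean mu (fun x => `|v (act h x) - v x|) = 0.
  apply: small => [|k]; first exact: mean_ge0.
  have bdn := bdd_measurable_norm (bd k).
  have b1 := bdd_measurable_norm (bdd_measurableB (bdd_measurable_act h (ba (r k))) (ba (r k))).
  have b2 := bdd_measurable_act h bdn.
  apply: (@le_trans _ _ (mean mu (fun x => `|v (act h x) - avg (F (r k)) f (act h x)| +
    `|avg (F (r k)) f (act h x) - avg (F (r k)) f x| + `|v x - avg (F (r k)) f x|))).
    apply: mean_le.
    - exact/bdd_measurable_norm/bdd_measurableB/bv/bdd_measurable_act.
    - by apply: bdd_measurableD => //; exact: bdd_measurableD.
    move=> x; rewrite [X in _ <= _ + X]distrC.
    apply: le_trans (lerD (ler_normD _ _) (lexx _)).
    apply: le_trans (ler_normD _ _).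
    by rewrite le_eqVlt; apply/orP; left; apply/eqP; congr (`| _ |); ring.
  rewrite meanD//; last exact: bdd_measurableD.
  rewrite meanD// (mean_act h bdn).
  by have := half0 k; have := hv k; have := (hn k).2 _ h (nr k); lra.
have vc := ergodic_const bv vinv.
move=> e e0.
have [k hk] : exists k, 2 * 2^-1 ^+ k <= e / 2.
  have [|k hk] := @exists_half_expr_le (e / 4); first by rewrite divr_gt0.
  by exists k; lra.
have e2 : 0 < e / 2 by rewrite divr_gt0.
have [N0 hN0] := coaveraging_avg bf (F0 (r k)) e2.
exists N0 => N /hN0 hN.
set u := avg (F (r k)) f in hN.
have bu : bdd_measurable u by exact: ba.
have bc := bdd_measurable_norm (bdd_measurableB bu (bdd_measurable_cst (mean mu f))).
apply: (@le_trans _ _ (mean mu (fun x => avg (F N) (fun y => `|u y - mean mu f|) x + e / 2))).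
  apply: mean_le.
  - exact/bdd_measurable_norm/bdd_measurableB/bdd_measurable_cst.
  - by apply: bdd_measurableD; [exact: bdd_measurable_avg|exact: bdd_measurable_cst].
  move=> x; have := hN x; have := avg_norm (F N) (fun y => u y - mean mu f) x.
  rewrite avgB avg_cst//; set p := avg _ _ _; set q := avg _ f x; set z := avg _ _ x.
  rewrite !ler_norml => /andP[? ?] /andP[? ?].
  by apply/andP; split; lra.
rewrite meanD; [|exact: bdd_measurable_avg|exact: bdd_measurable_cst].
rewrite mean_cst mean_avg// [leRHS]splitr lerD2r (le_trans _ hk)//.
apply: le_trans (hv k).
have bvc := bdd_measurable_norm (bdd_measurableB bv (bdd_measurable_cst (mean mu v))).
rewrite -[leRHS]addr0 -vc -meanD//; last exact/bdd_measurable_norm.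
apply: mean_le => //.
  by apply: bdd_measurableD => //; exact: bdd_measurable_norm.
move=> x; rewrite -vE [X in _ <= X + _]distrC -/u.
apply: le_trans (ler_normD _ _).
by rewrite le_eqVlt; apply/orP; left; apply/eqP; congr (`| _ |); ring.
Qed.

End MeanErgodic.

(** * Translates of a finite set inside another *)

Section Boundary.
Context {G : groupType}.
Local Open Scope fset_scope.
Implicit Types (K F : {fset G}).

(** The points j whose translate K j meets F. *)
Definition hull K F : {fset G} := [fset (k^-1 * f)%g | k in K, f in F].

Definition interior_pt K F : pred G :=
  fun j => (j \in F) && all (fun k => (k * j)%g \in F) K.

(** The translates of K cover each point of F exactly #|K| times; this is what
    makes the exponents in [shearer_expR] fit. *)
Lemma count_hull K F f : f \in F ->
  count (fun j => (f * j^-1)%g \in K) (hull K F) = #|` K|.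
Proof.
move=> fF; rewrite -size_filter.
have inj : injective (fun k : G => (k^-1 * f)%g).
  by move=> x y /mulIg /(can_inj invgK).
rewrite -[RHS](size_map (fun k : G => (k^-1 * f)%g)).
apply: perm_size; apply: uniq_perm.
- by rewrite filter_uniq ?fset_uniq.
- by rewrite map_inj_uniq ?fset_uniq.
move=> j; rewrite mem_filter; apply/andP/mapP => [[fj _]|[k kK ->]].
  by exists (f * j^-1)%g => //; rewrite invgM invgK mulgVK.
split; first by rewrite invgM invgK mulVKg.
by apply/imfset2P; exists k => //; exists f.
Qed.

Lemma count_interior K F : (count (interior_pt K F) (hull K F) <= #|` F|)%N.
Proof.
rewrite -size_filter; apply: uniq_leq_size; first by rewrite filter_uniq ?fset_uniq.
by move=> j; rewrite mem_filter => /andP[/andP[]].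
Qed.

(** Let K j meet F. If j is not in F, then j is in [k^-1 F] for some k in K; if j
    is in F and K j is not contained in F, then j is outside [k^-1 F] for some
    k in K. *)
Lemma count_boundary K F :
  (count (predC (interior_pt K F)) (hull K F)
   <= \sum_(k <- K) #|` symdiff F (translate k^-1 F)|)%N.
Proof.
have sub : {subset [seq j <- hull K F | predC (interior_pt K F) j] <=
    flatten [seq enum_fset (symdiff F (translate k^-1 F)) | k <- K]}.
  move=> j; rewrite mem_filter => /andP[nij /imfset2P[k /= kK [f /= fF jE]]].
  have tr (k' : G) : (j \in translate k'^-1 F) = ((k' * j)%g \in F).
    apply/imfsetP/idP => /= [[g gF ->]|kjF]; first by rewrite mulVKg.
    by exists (k' * j)%g => //; rewrite mulKg.
  apply/flattenP; have [jF|jF] := boolP (j \in F).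
    move: nij; rewrite /= /interior_pt jF/= => /allPn[k' k'K k'j].
    exists (enum_fset (symdiff F (translate k'^-1 F))).
      by apply/mapP; exists k'.
    by rewrite in_fsetU !in_fsetD tr jF (negPf k'j).
  exists (enum_fset (symdiff F (translate k^-1 F))); first by apply/mapP; exists k.
  rewrite in_fsetU !in_fsetD tr (negPf jF)/=.
  by rewrite jE mulVKg fF.
rewrite -size_filter (leq_trans (uniq_leq_size _ sub)) ?filter_uniq ?fset_uniq//.
by rewrite size_flatten /shape -map_comp sumnE big_map.
Qed.

End Boundary.

(** * Names of points and their number *)

Section Names.
Context {d : measure_display} {Y : measurableType d} {R : realType}.
Variable mu : probability Y R.
Context {G : groupType} (act : G -> Y -> Y).
Hypothesis mact : forall g, measurable_fun setT (act g).
Context {T : finType} (p : Y -> T).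
Hypothesis mp : forall t, measurable (p @^-1` [set t])%classic.
Implicit Types (F K : {fset G}).

Definition name F x : {ffun F -> T} := [ffun g => p (act (val g) x)].

Lemma measurable_name F (S : set {ffun F -> T}) :
  measurable (name F @^-1` S)%classic.
Proof.
have -> : (name F @^-1` S = \bigcup_(w in S) (name F @^-1` [set w]))%classic.
  apply/seteqP; split => x /= => [Sx|[w Sw /= ->] //].
  by exists (name F x).
apply: fin_bigcup_measurable => [|w _]; first exact: finite_finset.
have -> : (name F @^-1` [set w] =
    \bigcap_(g in [set: F]) (act (val g) @^-1` (p @^-1` [set w g])))%classic.
  apply/seteqP; split => x /= => [<- g _|h]; first by rewrite /= ffunE.
  by apply/ffunP => g; rewrite ffunE; exact: (h g).
apply: fin_bigcap_measurable => [|g _]; first exact: finite_finset.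
by rewrite -[X in measurable X]setTI; exact: mact.
Qed.

Definition nameP F (w : {ffun F -> T}) : R := pr mu (name F @^-1` [set w])%classic.

Lemma bdd_measurable_name F (e : {ffun F -> T} -> R) :
  bdd_measurable (fun x => e (name F x)).
Proof.
split; first by move=> _ B mB; rewrite setTI; exact: (measurable_name (e @^-1` B)%classic).
exists (\sum_w `|e w|) => x; rewrite (bigD1 (name F x))//= lerDl.
exact: sumr_ge0.
Qed.

Lemma mean_name F (e : {ffun F -> T} -> R) :
  mean mu (fun x => e (name F x)) = \sum_w e w * nameP w.
Proof.
have -> : (fun x => e (name F x)) =
    (fun x => \sum_w e w * \1_((name F @^-1` [set w])%classic) x).
  apply/funext => x; rewrite (bigD1 (name F x))//= indicE mem_set//= mulr1.
  rewrite big1 ?addr0// => w /eqP wx; rewrite indicE memNset ?mulr0//= => xw.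
  by apply: wx.
have bi w : bdd_measurable (\1_((name F @^-1` [set w])%classic) : Y -> R).
  by apply: bdd_measurable_indic; exact: measurable_name.
rewrite mean_sum => [|w]; last exact: bdd_measurableZ.
apply: eq_bigr => w _; rewrite meanZ// mean_indic//; exact: measurable_name.
Qed.

Lemma pr_name F (S : {set {ffun F -> T}}) :
  pr mu (name F @^-1` [set` S])%classic = \sum_(w in S) nameP w.
Proof.
rewrite -mean_indic; last exact: measurable_name.
rewrite (_ : \1__ = fun x => (name F x \in S)%:R : R); last first.
  by apply/funext => x; rewrite indicE; congr (nat_of_bool _)%:R; apply/idP/idP;
    rewrite inE.
rewrite (mean_name (fun w => (w \in S)%:R)) [RHS]big_mkcond/=; apply: eq_bigr => w _.
by case: ifP; rewrite ?mul1r ?mul0r.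
Qed.

Lemma nameP_ge0 F (w : {ffun F -> T}) : 0 <= nameP w.
Proof. exact: pr_ge0. Qed.

Lemma nameP_le1 F (w : {ffun F -> T}) : nameP w <= 1.
Proof. by apply: pr_le1; exact: measurable_name. Qed.

Lemma sum_nameP F : \sum_(w : {ffun F -> T}) nameP w = 1.
Proof.
rewrite -[RHS](mean_cst mu) (mean_name (F := F) (fun=> 1)).
by apply: eq_bigr => w _; rewrite mul1r.
Qed.

Definition name_entropy F : R := - \sum_(w : {ffun F -> T}) nameP w * ln (nameP w).

(** The law of the names, except that a null name gets a positive weight, so
    that its logarithm is meaningful; the extra mass, at most 1, costs a factor
    2 per translate in [name_count], which disappears as K grows. *)
Definition nameQ K (w : {ffun K -> T}) : R :=
  if nameP w == 0 then #|{: {ffun K -> T}}|%:R^-1 else nameP w.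

Lemma nameQ_gt0 K w : 0 < @nameQ K w.
Proof.
rewrite /nameQ; case: eqVneq => [_|ne]; last by rewrite lt0r ne nameP_ge0.
by rewrite invr_gt0 ltr0n; apply/card_gt0P; exists w.
Qed.

Lemma nameQ_le1 K w : @nameQ K w <= 1.
Proof.
rewrite /nameQ; case: eqVneq => [_|_]; last exact: nameP_le1.
by rewrite invf_le1 ?ler1n ?ltr0n//; apply/card_gt0P; exists w.
Qed.

Lemma sum_nameQ K : \sum_w @nameQ K w <= 2.
Proof.
apply: (@le_trans _ _ (\sum_w (nameP w + #|{: {ffun K -> T}}|%:R^-1))).
  apply: ler_sum => w _; rewrite /nameQ; case: eqVneq => [->|_].
    by rewrite add0r.
  by rewrite lerDl invr_ge0.
rewrite big_split/= sum_nameP sumr_const -[X in _ + X]mulr_natl.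
case: (posnP #|{: {ffun K -> T}}|) => [->|h]; first by rewrite mul0r; lra.
by rewrite divff ?pnatr_eq0 -?lt0n//; lra.
Qed.

(** The information of a point with respect to its K-name; its mean is the
    entropy ([mean_code]). *)
Definition code K x : R := - ln (nameQ (name K x)).

Lemma code_ge0 K x : 0 <= code K x.
Proof. by rewrite oppr_ge0 ln_le0// nameQ_le1. Qed.

Lemma bdd_measurable_code K : bdd_measurable (code K).
Proof. exact: (bdd_measurable_name (fun w => - ln (nameQ w))). Qed.

Lemma mean_code K : mean mu (code K) = name_entropy K.
Proof.
rewrite (mean_name (fun w => - ln (nameQ w))) /name_entropy -sumrN.
apply: eq_bigr => w _; rewrite /nameQ; case: eqVneq => [->|_].
  by rewrite mulr0 mul0r oppr0.
by rewrite mulNr mulrC.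
Qed.

Hypothesis actM : forall g h x, act (g * h)%g x = act g (act h x).

(** The translates K j of K, for j in the hull, are fed to [shearer_expR] with
    the weight of the K-name read at j. The right-hand side has one factor at
    most 2 for each interior translate and one factor [#|T| ^ #|K|] for each
    boundary one, before the power 1 / #|K|; each name of S contributes at
    least [expR (- b / #|K|)] to the left-hand side. *)
Lemma name_count K F (b : R) (S : {set {ffun F -> T}}) :
  K != fset0 ->
  (forall w, w \in S -> exists2 x, name F x = w &
    \sum_(g <- F) code K (act g x) <= b) ->
  #|S|%:R <= expR ((b + #|` F|%:R * ln 2) / #|` K|%:R +
    (count (predC (interior_pt K F)) (hull K F))%:R * ln #|T|%:R).
Proof.
move=> K0 hS; have [->|/set0Pn[w0 w0S]] := eqVneq S finset.set0.
  by rewrite cards0 expR_ge0.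
have [x0 _ _] := hS _ w0S; pose t0 := p x0.
have T1 : 1 <= #|T|%:R :> R by rewrite ler1n; apply/card_gt0P; exists t0.
have m_gt0 : (0 < #|` K|)%N by rewrite cardfs_gt0.
have m0 : 0 < #|` K|%:R :> R by rewrite ltr0n.
pose A (j : G) : {set F} := [set i : F | ((val i : G) * j^-1)%g \in K].
pose look (w : {ffun F -> T}) (g : G) : T := oapp w t0 (insub g).
pose h (j : G) (w : {ffun F -> T}) : {ffun K -> T} :=
  [ffun k => look w ((val k : G) * j)%g].
(* The translates that are not interior are given the weight 1. *)
pose u (j : G) (w : {ffun F -> T}) : R :=
  if interior_pt K F j then ln (nameQ (h j w)) else 0.
have lookE w (i : F) : look w (val i) = w i by rewrite /look valK.
have hA j (w w' : {ffun F -> T}) : (forall i, i \in A j -> w i = w' i) -> h j w = h j w'.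
  move=> ww'; apply/ffunP => k; rewrite !ffunE /look.
  case: insubP => //= i _ iE; apply: ww'; rewrite inE.
  have -> : (\val i : G) = (\val k * j)%g by exact: iE.
  by rewrite mulgK; exact: valP.
have uA j (w w' : {ffun F -> T}) : (forall i, i \in A j -> w i = w' i) -> u j w = u j w'.
  by move=> ww'; rewrite /u (hA _ _ _ ww').
have hinj j w : {in cyl (A j) w &, injective (h j)}.
  move=> w1 w2 /cylP c1 /cylP c2 /ffunP e; apply/ffunP => i.
  have [iA|iA] := boolP (i \in A j); last by rewrite c1// c2.
  move: (iA); rewrite inE => kK.
  have := e [` kK]%fset; rewrite !ffunE /= mulgVK.
  by rewrite !lookE.
have sum_h j w (e : {ffun K -> T} -> R) : (forall v, 0 <= e v) ->
    \sum_(w' in cyl (A j) w) e (h j w') <= \sum_v e v.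
  move=> e0; rewrite -(big_imset e (hinj j w))/= [leRHS](bigID (mem (h j @: cyl (A j) w)))/=.
  by rewrite lerDl sumr_ge0.
have L j w : ln (\sum_(w' in cyl (finset.setT :&: A j) w) expR (u j w')) <=
    if interior_pt K F j then ln 2 else #|` K|%:R * ln #|T|%:R.
  rewrite finset.setTI /u; case: ifP => ij.
    have -> : \sum_(w' in cyl (A j) w) expR (ln (nameQ (h j w'))) =
        \sum_(w' in cyl (A j) w) nameQ (h j w').
      by apply: eq_bigr => w' _; rewrite lnK// posrE nameQ_gt0.
    have le2 := le_trans (sum_h j w _ (fun v => ltW (nameQ_gt0 v))) (sum_nameQ K).
    rewrite ler_ln ?posrE//; rewrite (bigD1 w)/=; last exact/cylP.
    by rewrite ltr_pwDl ?nameQ_gt0// sumr_ge0// => v _; rewrite ltW ?nameQ_gt0.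
  have le1 := sum_h j w (fun=> 1) (fun=> ler01).
  rewrite expR0 mulr_natl -lnXn ?(lt_le_trans ltr01)//.
  rewrite ler_ln ?posrE ?exprn_gt0 ?(lt_le_trans ltr01)//; last first.
    by rewrite sumr_const ler1n; apply/card_gt0P; exists w; exact/cylP.
  by apply: (le_trans le1); rewrite sumr_const card_ffun natrX cardfE.
have Ucount i : i \in (finset.setT : {set F}) -> count (fun j => i \in A j) (hull K F) = #|` K|.
  move=> _; rewrite -(count_hull K (valP i)); apply: eq_count => j.
  by rewrite inE.
have := @shearer_expR R F T G (hull K F) A u _ finset.setT m_gt0 uA Ucount w0.
have cT w : w \in cyl finset.setT w0 by apply/cylP => i; rewrite inE.
have lower w : w \in S ->
    expR (- b / #|` K|%:R) <= expR ((\sum_(j <- hull K F) u j w) / #|` K|%:R).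
  move=> wS; have [x xw hx] := hS _ wS.
  rewrite ler_expR ler_pM2r ?invr_gt0// lerNl; apply: le_trans hx.
  rewrite -sumrN (eq_bigr (fun j => if interior_pt K F j then code K (act j x) else 0)).
    rewrite -big_mkcond -big_filter.
    set s := [seq _ <- _ | _].
    rewrite [leRHS](bigID (mem s))/= -[leLHS]addr0 lerD//.
      rewrite -[X in _ <= X]big_filter le_eqVlt; apply/orP; left; apply/eqP.
      apply: perm_big; apply: uniq_perm; rewrite ?filter_uniq ?fset_uniq//.
      move=> j; rewrite [in RHS]mem_filter /=; case: (boolP (j \in s)) => //=.
      by rewrite mem_filter => /andP[/andP[->]].
    by apply: sumr_ge0 => j _; exact: code_ge0.
  move=> j _; rewrite /u; case: ifP => [ij|_]; last by rewrite oppr0.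
  congr (- ln (nameQ _)); apply/ffunP => k; rewrite !ffunE -actM /look.
  have kjF : ((val k : G) * j)%g \in F.
    by case/andP: ij => _ /allP; apply; exact: valP.
  by rewrite (insubT (fun g => g \in F) kjF) /= -xw ffunE.
have cardS : #|S|%:R * expR (- b / #|` K|%:R) <=
    \sum_(w' in cyl finset.setT w0) expR ((\sum_(j <- hull K F) u j w') / #|` K|%:R).
  rewrite mulr_natl -sumr_const [leLHS]big_mkcond [leRHS]big_mkcond/=.
  apply: ler_sum => w _; rewrite cT; case: ifP => [/lower //|_].
  exact: expR_ge0.
move=> /(le_trans cardS) {cardS}.
rewrite mulNr expRN ler_pdivrMr ?expR_gt0// -expRD => /le_trans; apply.
rewrite ler_expR addrC mulrDl -addrA lerD2l.
apply: (@le_trans _ _ ((\sum_(j <- hull K F)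
    if interior_pt K F j then ln 2 else #|` K|%:R * ln #|T|%:R) / #|` K|%:R)).
  by rewrite ler_pM2r ?invr_gt0//; apply: ler_sum => j _; exact: L.
rewrite (bigID (interior_pt K F))/= mulrDl; apply: lerD.
  rewrite ler_pM2r ?invr_gt0//.
  rewrite (eq_bigr (fun=> ln 2)); last by move=> j ->.
  rewrite big_const_seq iter_addr_0 -[leLHS]mulr_natl ler_wpM2r ?ln_ge0 ?ler1n ?ler_nat//.
  exact: count_interior.
rewrite (eq_bigr (fun=> #|` K|%:R * ln #|T|%:R)); last by move=> j /negPf ->.
by rewrite big_const_seq iter_addr_0 -[X in X / _]mulr_natl mulrCA mulrAC divff ?mul1r ?gt_eqF.
Qed.

End Names.

(** * Typical names *)

Section TypicalNames.
Context {d : measure_display} {Y : measurableType d} {R : realType}.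
Variable mu : probability Y R.
Context {G : groupType} (act : G -> Y -> Y).
Hypothesis act1 : forall x, act 1%g x = x.
Hypothesis actM : forall g h x, act (g * h)%g x = act g (act h x).
Hypothesis mact : forall g, measurable_fun setT (act g).
Hypothesis inv : forall g (A : set Y), measurable A ->
  mu (act g @^-1` A)%classic = mu A.
Hypothesis Gcount : countable [set: G].
Hypothesis erg : forall A : set Y, measurable A ->
  (forall g, act g @^-1` A = A)%classic -> mu A = 0%E \/ mu A = 1%E.
Variable F : nat -> {fset G}.
Hypothesis Ffol : Folner R F.
Context {T : finType} (p : Y -> T).
Hypothesis mp : forall t, measurable (p @^-1` [set t])%classic.

Local Notation H := (name_entropy mu act p).
Local Notation nameP := (nameP mu act p).
Local Notation logT := (ln (#|T|%:R : R)).

Lemma label_card_gt0 : (0 < #|T|)%N.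
Proof. by apply/card_gt0P; exists (p point). Qed.

Lemma ln_label_card_ge0 : 0 <= logT.
Proof. by rewrite ln_ge0// ler1n label_card_gt0. Qed.

Lemma boundary_small (K : {fset G}) (e : R) : 0 < e -> exists N0 : nat,
  forall N, (N0 <= N)%N ->
    (count (predC (interior_pt K (F N))) (hull K (F N)))%:R <= e * #|` F N|%:R.
Proof.
move=> e0.
suff [N0 hN0] : exists N0 : nat, forall N, (N0 <= N)%N ->
    (\sum_(k <- K) #|` symdiff (F N) (translate k^-1 (F N))|)%:R <= e * #|` F N|%:R.
  exists N0 => N /hN0; apply: le_trans; rewrite ler_nat; exact: count_boundary.
elim: (enum_fset K) e e0 => [|k s IH] e e0.
  by exists 0%N => N _; rewrite big_nil mulr_ge0// ltW.
have e2 : 0 < e / 2 by rewrite divr_gt0.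
have [N1 hN1] := IH _ e2.
have /cvgrPdist_le/(_ _ e2)[N2 _ hN2] := Ffol.2 (k^-1)%g.
exists (maxn N1 N2) => N; rewrite geq_max => /andP[/hN1 h1 /hN2/= h2].
have F0 : 0 < #|` F N|%:R :> R by rewrite ltr0n cardfs_gt0 Ffol.1.
rewrite big_cons natrD [e]splitr mulrDl lerD//.
move: h2; rewrite sub0r normrN ger0_norm ?divr_ge0// ler_pdivrMr//.
Qed.

(** The names counted are those of the points at which the average of the
    information is at most its mean plus eta; by the mean ergodic theorem and
    Markov's inequality these are most points. *)
Lemma typical_names (K : {fset G}) (h eta : R) : K != fset0 -> 0 < eta ->
  H K <= h * #|` K|%:R -> ln 2 <= eta * #|` K|%:R ->
  exists N0 : nat, forall N, (N0 <= N)%N ->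
    exists S : {set {ffun F N -> T}},
      #|S|%:R <= expR (#|` F N|%:R * (h + 3 * eta)) /\
      1 - eta <= \sum_(w in S) nameP w.
Proof.
move=> K0 eta0 hK lnK.
have m1 : 1 <= #|` K|%:R :> R by rewrite ler1n cardfs_gt0.
have m0 : 0 < #|` K|%:R :> R by rewrite (lt_le_trans ltr01).
pose phi : Y -> R := code mu act p K.
have bphi : bdd_measurable phi by exact: bdd_measurable_code.
have mphi : mean mu phi = H K by exact: mean_code.
have eta2 : 0 < eta ^+ 2 by rewrite exprn_gt0.
have [N1 hN1] := mean_ergodic actM mact inv Ffol act1 Gcount erg bphi eta2.
have e0 : 0 < eta / (logT + 1).
  by rewrite divr_gt0// ltr_wpDl// ln_label_card_ge0.
have [N2 hN2] := boundary_small K e0.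
exists (maxn N1 N2) => N; rewrite geq_max => /andP[/hN1 h1 /hN2 h2].
have F0 : 0 < #|` F N|%:R :> R by rewrite ltr0n cardfs_gt0 Ffol.1.
pose b : R := #|` F N|%:R * (H K + eta).
pose S : {set {ffun F N -> T}} := [set w : {ffun F N -> T} |
  `[< exists2 x, name act p (F N) x = w & \sum_(g <- F N) phi (act g x) <= b >]].
exists S; split.
  have hS (w : {ffun F N -> T}) : w \in S -> exists2 x, name act p (F N) x = w &
      \sum_(g <- F N) phi (act g x) <= b by rewrite inE => /asboolP.
  apply: (le_trans (name_count mact mp actM K0 hS)); rewrite ler_expR.
  have a1 : (b + #|` F N|%:R * ln 2) / #|` K|%:R <= #|` F N|%:R * (h + 2 * eta).
    rewrite ler_pdivrMr// /b -mulrDr -mulrA ler_wpM2l//.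
    have : eta <= eta * #|` K|%:R by rewrite ler_peMr// ltW.
    by lra.
  have a2 : (count (predC (interior_pt K (F N))) (hull K (F N)))%:R * logT
      <= #|` F N|%:R * eta.
    apply: (le_trans (ler_wpM2r ln_label_card_ge0 h2)).
    rewrite mulrAC [leRHS]mulrC ler_wpM2r// mulrAC ler_pdivrMr.
      by rewrite ler_wpM2l ?(ltW eta0)// lerDl.
    by rewrite ltr_wpDl// ln_label_card_ge0.
  by lra.
rewrite -(pr_name _ mact mp).
pose dev x := `|avg act (F N) phi x - mean mu phi|.
have bdev : bdd_measurable dev.
  apply/bdd_measurable_norm/bdd_measurableB; last exact: bdd_measurable_cst.
  exact: bdd_measurable_avg.
have mS := measurable_superlevel eta bdev.
apply: (@le_trans _ _ (pr mu (~` [set x | eta <= dev x])%classic)).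
  rewrite prC// lerD2l lerN2.
  apply: (le_trans (pr_markov mu bdev eta0 _)) => [x|]; first exact: normr_ge0.
  by rewrite ler_pdivrMr// -expr2.
apply: pr_le; [exact: measurableC|exact: measurable_name|].
move=> x /= /negP; rewrite -ltNge => dx; rewrite inE; apply/asboolP; exists x => //.
move: dx; rewrite /dev mphi => /(le_lt_trans (ler_norm _)).
rewrite ltrBlDl /avg ltr_pdivrMr//.
by rewrite /b [X in _ -> _ <= X]mulrC => /ltW.
Qed.

Section Rate.
(* The hypotheses hr_le and hr_ge say that hr is the limit inferior of
   H (F N) / #|F N|. *)
Variable hr : R.
Hypothesis hr_ge0 : 0 <= hr.
Hypothesis hr_le : forall eta, 0 < eta -> exists N0 : nat, forall N, (N0 <= N)%N ->
  #|` F N|%:R * (hr - eta) <= H (F N).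
Hypothesis hr_ge : forall eta, 0 < eta -> forall N0 : nat, exists N,
  (N0 <= N)%N /\ H (F N) <= #|` F N|%:R * (hr + eta).
Hypothesis Fcard : forall x : R, exists N0 : nat, forall N, (N0 <= N)%N ->
  x <= #|` F N|%:R.

Lemma typical_names_rate (eta : R) : 0 < eta ->
  exists N0 : nat, forall N, (N0 <= N)%N ->
    exists S : {set {ffun F N -> T}},
      #|S|%:R <= expR (#|` F N|%:R * (hr + eta)) /\
      1 - eta <= \sum_(w in S) nameP w.
Proof.
move=> eta0; have e4 : 0 < eta / 4 by rewrite divr_gt0.
have [N1 hN1] := Fcard (ln 2 / (eta / 4)).
have [n [/hN1 n1 hn]] := hr_ge e4 N1.
have [] := @typical_names (F n) (hr + eta / 4) (eta / 4) (Ffol.1 n) e4.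
- by rewrite mulrC.
- by rewrite mulrC -ler_pdivrMr.
move=> N0 hN0; exists N0 => N /hN0[S [S1 S2]]; exists S; split.
  by apply: (le_trans S1); rewrite ler_expR ler_wpM2l//; lra.
by apply: le_trans S2; lra.
Qed.

(** Suppose that Q is smaller. The names split into Q, the rest of a typical
    set S, and a remainder of mass e; by [entropy_grouping] their entropy is at
    most #|F N| hr - beta eta #|F N| up to errors of order e #|F N|, which
    contradicts hr_le. *)
Lemma many_names (beta eta : R) : 0 < beta -> 0 < eta ->
  exists N0 : nat, forall N, (N0 <= N)%N -> forall Q : {set {ffun F N -> T}},
    beta <= \sum_(w in Q) nameP w ->
    expR (#|` F N|%:R * (hr - eta)) <= #|Q|%:R.
Proof.
move=> b0 eta0; have lT := ln_label_card_ge0.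
(* The errors add up to (2 + logT) e, a quarter of the gain beta eta. *)
pose e := beta * eta / (4 * (2 + logT)).
have e0 : 0 < e by rewrite divr_gt0 ?mulr_gt0//; lra.
have be0 : 0 < beta * eta by rewrite mulr_gt0.
have [N1 hN1] := hr_le e0.
have [N2 hN2] := typical_names_rate e0.
have [N3 hN3] := Fcard (ln 3 * 4 / (beta * eta)).
exists (maxn N1 (maxn N2 N3)) => N; rewrite !geq_max => /and3P[/hN1 h1 /hN2 h2 /hN3 h3] Q hQ.
rewrite leNgt; apply/negP => /ltW cQ.
have F0 : 0 < #|` F N|%:R :> R by rewrite ltr0n cardfs_gt0 Ffol.1.
have [S [S1 S2]] := h2.
have cW : #|{: {ffun F N -> T}}|%:R <= expR (#|` F N|%:R * logT).
  by rewrite mulrC expRM_natr lnK ?posrE ?ltr0n ?label_card_gt0// -natrX card_ffun cardfE.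
have a0 : 0 <= #|` F N|%:R * (hr + e) by rewrite mulr_ge0// addr_ge0// ltW.
have c0 : 0 <= #|` F N|%:R * logT by rewrite mulr_ge0.
have := entropy_grouping (@nameP_ge0 _ _ _ mu _ act _ p (F N))
  (sum_nameP mu mact mp (F N)) a0 c0 cQ S1 cW S2.
rewrite -/(H (F N)) => h4.
move: h1 h3 h4 hQ; set q := \sum_(w in Q) _; set n : R := #|` F N|%:R in F0 a0 c0 *.
have q1 : q <= 1.
  rewrite -(sum_nameP mu mact mp (F N)) [leRHS](bigID (mem Q))/= lerDl.
  by apply: sumr_ge0 => w _; exact: nameP_ge0.
rewrite ler_pdivrMr// => h1 h3 h4 hQ.
have eE : e * (2 + logT) = beta * eta / 4.
  by rewrite /e; field; rewrite gt_eqF//; lra.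
have h5 : n * (hr - e) <= ln 3 + n * hr - q * n * eta + n * e + n * e * logT.
  apply: (le_trans h1); apply: (le_trans h4).
  have : 0 <= q * (n * e).
    apply: mulr_ge0; first exact: le_trans (ltW b0) hQ.
    by rewrite mulr_ge0// ltW.
  by lra.
have h6 : n * (q * eta) <= ln 3 + n * (beta * eta / 4).
  rewrite -eE; by lra.
have h7 : n * (beta * eta) <= n * (q * eta).
  by rewrite ler_wpM2l ?(ltW F0)// ler_wpM2r ?(ltW eta0).
have : 0 < n * (beta * eta) by rewrite mulr_gt0.
by lra.
Qed.

End Rate.
End TypicalNames.

(** * Borel sets of a metric space *)

Section BorelMetric.
Local Open Scope classical_set_scope.
Local Open Scope ring_scope.
Context {R : realType} {X : pointedMetricType R}.
Variable mu : probability (borel X) R.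

Lemma open_mball (x : X) (e : R) : open (ball x e).
Proof.
rewrite openE => y; rewrite ballEmdist/= => xy.
apply/nbhs_ballP; exists (e - mdist x y); first by rewrite /= subr_gt0.
move=> z; rewrite !ballEmdist/= => yz.
by rewrite (le_lt_trans (metric_triangle x y z))// -ltrBrDl.
Qed.

Lemma open_borel (U : set X) : open U -> measurable (U : set (borel X)).
Proof. by move=> oU; apply: sub_sigma_algebra. Qed.

Lemma continuous_borel (f : X -> X) : continuous f ->
  measurable_fun [set: borel X] (f : borel X -> borel X).
Proof.
move=> cf; apply: (@measurability _ _ (borel X) (borel X) setT f (@open X)) => // _ [U oU <-].
rewrite setTI; apply: open_borel.
by apply: open_comp => // x _; exact: cf.
Qed.

(** This substitute for the regularity of the measure is stable under
    complements and countable unions, and holds for an open set U: remove the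
    points of U that are too close to its complement. *)
Lemma borel_separation (A : set (borel X)) : measurable A -> forall kappa : R,
  0 < kappa -> exists (e : R) (B : set (borel X)),
    [/\ 0 < e, measurable B, pr mu B <= kappa &
      forall x y : X, ~ B x -> ~ B y -> mdist x y < e -> A x -> A y].
Proof.
pose C : set (set (borel X)) := [set A : set (borel X) | measurable A /\ forall kappa : R,
  0 < kappa -> exists (e : R) (B : set (borel X)),
    [/\ 0 < e, measurable B, pr mu B <= kappa &
      forall x y : X, ~ B x -> ~ B y -> mdist x y < e -> A x -> A y]].
suff sub : @measurable _ (borel X) `<=` C by move=> /sub[].
have pr0 : pr mu set0 = 0 by rewrite /pr measure0.
have C0 : C set0.
  split; first exact: measurable0.
  by move=> k k0; exists 1, set0; split => //; rewrite pr0 ltW.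
have CU (A1 A2 : set (borel X)) : C A1 -> C A2 -> C (A1 `|` A2).
  move=> [m1 h1] [m2 h2]; split; first exact: measurableU.
  move=> k k0; have k2 : 0 < k / 2 by rewrite divr_gt0.
  have [e1 [B1 [e10 mB1 k1 s1]]] := h1 _ k2.
  have [e2 [B2 [e20 mB2 k3 s2]]] := h2 _ k2.
  exists (Num.min e1 e2), (B1 `|` B2); split.
  - by rewrite lt_min e10.
  - exact: measurableU.
  - by rewrite (le_trans (prU_le _ _ _))// [leRHS]splitr lerD.
  move=> x y nx ny; rewrite lt_min => /andP[xy1 xy2] [Ax|Ax]; [left|right].
    by apply: (s1 x y) => // ?; [apply: nx; left|apply: ny; left].
  by apply: (s2 x y) => // ?; [apply: nx; right|apply: ny; right].
apply: smallest_sub.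
  split => //.
    move=> A1 [mA hA]; rewrite setTD; split; first exact: measurableC.
    move=> k /hA[e [B [e0 mB Bk s]]]; exists e, B; split => // x y nx ny xy nAx Ay.
    by apply: nAx; apply: (s y x) => //; rewrite metric_sym.
  move=> A1 CA; have mU : measurable (\bigcup_k A1 k : set (borel X)).
    by apply: bigcupT_measurable => k; have [] := CA k.
  split => // k k0; have k2 : 0 < k / 2 by rewrite divr_gt0.
  pose U n : set (borel X) := \big[setU/set0]_(i < n) A1 i.
  have CUn n : C (U n).
    by rewrite /U; elim: n => [|n IH]; rewrite ?big_ord0// big_ord_recr/=; exact: CU.
  pose D n : set (borel X) := (\bigcup_k A1 k) `\` U n.
  have mD n : measurable (D n) by apply: measurableD => //; have [] := CUn n.
  have [] := @pr_decreasing_small _ _ _ mu D _ mD _ _ k2.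
  - move=> n x [Ux nUx]; split => // Unx; apply: nUx.
    by rewrite /U big_ord_recr/=; left.
  - rewrite -subset0 => x /= h; have [[j _ Ajx] _] := h 0%N I.
    have [_ /(_ _)] := h j.+1 I; apply.
    by rewrite /U big_ord_recr/=; right.
  move=> n Dn; have [_ /(_ _ k2)[e [B [e0 mB Bk s]]]] := CUn n.
  exists e, (B `|` D n); split => //.
  - exact: measurableU.
  - by rewrite (le_trans (prU_le _ _ _))// [leRHS]splitr lerD.
  move=> x y nx ny xy Ax.
  have [Ux|nUx] := pselect (U n x); last by case: nx; right.
  have : U n y by apply: (s x y) => // ?; [apply: nx; left|apply: ny; left].
  rewrite /U -(bigcup_mkord n A1) => -[i _ Aiy]; by exists i.
move=> U oU; split; first exact: open_borel.
move=> k k0.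
pose V n : set (borel X) := U `&` \bigcup_(y in ~` U) ball (y : X) (n.+1%:R^-1).
have mV n : measurable (V n).
  apply: open_borel; apply: openI => //; apply: bigcup_open => y _.
  exact: open_mball.
have [] := @pr_decreasing_small _ _ _ mu V _ mV _ _ k0.
- move=> n x [Ux [y nUy yx]]; split => //; exists y => //.
  apply: le_ball yx; rewrite lef_pV2 ?posrE// ler_nat//.
- rewrite -subset0 => x /= h; have [Ux _] := h 0%N I.
  have /nbhs_ballP[e /= e0 xeU] : nbhs x U by exact: open_nbhs_nbhs.
  have [n _ /(_ n (leqnn n)) ne] := near_infty_natSinv_lt (PosNum e0).
  have [_ [y nUy yx]] := h n I; apply: nUy; apply: xeU.
  by apply: le_ball (ball_sym yx); exact: ltW.
move=> n Vn; exists n.+1%:R^-1, (V n); split => //.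
move=> x y nx ny xy Ux; apply: contrapT => nUy; apply: nx; split => //.
by exists y => //; rewrite ballEmdist/= metric_sym.
Qed.

End BorelMetric.

(** * Names and Bowen balls *)

Section Covering.
Context {R : realType} {G : groupType} {X : pointedMetricType R}.
Variables (act : G -> X -> X) (mu : probability (borel X) R).
Context {T : finType} (p : X -> T).
Hypothesis mp : forall t, measurable (p @^-1` [set t] : set (borel X))%classic.
Hypothesis mact : forall g,
  measurable_fun [set: borel X] (act g : borel X -> borel X).

Local Notation nameB := (@name _ (borel X) G act T p).
Local Notation nameP := (@nameP _ (borel X) R mu G act T p).

(** The label takes finitely many values, so finitely many applications of
    [borel_separation] are enough. *)
Lemma label_separation (kappa : R) : 0 < kappa ->
  exists (e : R) (B : set (borel X)), [/\ 0 < e, measurable B, pr mu B <= kappa &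
    forall x y : X, ~ B x -> ~ B y -> mdist x y < e -> p x = p y].
Proof.
move=> k0.
suff [e [B [e0 mB Bk s]]] : exists (e : R) (B : set (borel X)),
    [/\ 0 < e, measurable B, pr mu B <= kappa &
    forall x y : X, ~ B x -> ~ B y -> mdist x y < e ->
      forall t, t \in enum T -> p x = t -> p y = t].
  exists e, B; split => // x y nx ny xy.
  by apply/esym; apply: (s x y) => //; rewrite mem_enum.
elim: (enum T) kappa k0 => [|t s IH] k k0.
  exists 1, classical_sets.set0; split => //.
  by rewrite /pr measure0 ltW.
have k2 : 0 < k / 2 by rewrite divr_gt0.
have [e1 [B1 [e10 mB1 Bk1 s1]]] := IH _ k2.
have [e2 [B2 [e20 mB2 Bk2 s2]]] := borel_separation mu (mp t) k2.
exists (Num.min e1 e2), (B1 `|` B2)%classic; split.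
- by rewrite lt_min e10.
- exact: measurableU.
- by rewrite (le_trans (prU_le _ _ _))// [leRHS]splitr lerD.
move=> x y nx ny; rewrite lt_min => /andP[xy1 xy2] u.
rewrite inE => /predU1P[->|us].
  by apply: (s2 x y) => // ?; [apply: nx; right|apply: ny; right].
by apply: (s1 x y) => // ?; [apply: nx; left|apply: ny; left].
Qed.

Lemma covering_number_le (F : {fset G}) (e delta : R) (S : {set {ffun F -> T}}) :
  (forall x y, p x = p y -> mdist x y < e) ->
  1 - delta <= \sum_(w in S) nameP w ->
  (covering_number act mu F e delta <= #|S|%:R%:E)%E.
Proof.
move=> pe hS; apply: ereal_inf_lbound; exists #|S| => //=.
exists (fun i : 'I_#|S| => xget point [set x | nameB F x = enum_val i]%classic).
exists (nameB F @^-1` [set` S])%classic; split.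
- exact: measurable_name.
- move=> x /= xS; exists (enum_rank_in xS (nameB F x)) => //.
  rewrite enum_rankK_in//; case: xgetP => [y _ /= yx|/(_ x)[]//].
  move=> g gF; apply: pe; move/ffunP: yx => /(_ [` gF]%fset).
  by rewrite !ffunE.
- apply: (@le_trans _ _ (pr mu (nameB F @^-1` [set` S])%classic)%:E).
    by rewrite lee_fin pr_name.
  by rewrite prE//; exact: measurable_name.
Qed.

Lemma covering_number_ge (F : {fset G}) (e delta b : R) :
  (forall k (c : 'I_k -> X) (A : set (borel X)), measurable A ->
     (A `<=` \bigcup_(i in [set: 'I_k]) bowen_ball act F (c i) e)%classic ->
     1 - delta <= pr mu A -> b <= k%:R) ->
  (b%:E <= covering_number act mu F e delta)%E.
Proof.
move=> h; apply: le_ereal_inf_tmp => _ [k /= [c [A [mA Asub hA]]] <-].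
by rewrite lee_fin; apply: (h k c A) => //; rewrite -lee_fin prE//; exact: hA.
Qed.

Hypothesis inv : forall g (A : set (borel X)), measurable A ->
  mu (act g @^-1` A)%classic = mu A.

(** Two points of a Bowen ball have the same label at each time at which both
    orbits avoid B. The names counted here thus lie in a Hamming ball of radius
    2 a around any of them. *)
Lemma names_in_bowen_ball (F : {fset G}) (c : X) (e a r : R) (B : set (borel X)) :
  (forall x y : X, ~ B x -> ~ B y -> mdist x y < 2 * e -> p x = p y) ->
  0 < r -> r <= 1 ->
  #|[set w : {ffun F -> T} | `[< exists x, [/\ bowen_ball act F c e x,
      \sum_(g <- F) \1_B (act g x) <= a & nameB F x = w] >]]|%:R
  <= expR (#|T|%:R * r * #|` F|%:R - 2 * a * ln r).
Proof.
move=> sep r0 r1; set Q := [set w | _]%SET.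
have [->|/set0Pn[w0]] := eqVneq Q finset.set0; first by rewrite cards0 expR_ge0.
rewrite inE => /asboolP[x0 [cx0 ax0 w0E]].
have visits x : \sum_(g <- F) \1_B (act g x) = #|[set i : F | `[< B (act (val i) x) >]]|%:R :> R.
  rewrite big_seq_fsetE/= -sumr_const [RHS]big_mkcond/=; apply: eq_bigr => i _.
  rewrite indicE inE.
  by have [Bx|Bx] := pselect (B (act (fsval i) x));
    [rewrite mem_set// asboolT|rewrite memNset// asboolF].
have a0 : 0 <= a.
  by apply: le_trans ax0; rewrite visits.
pose n := Num.truncn (2 * a).
have sub : Q \subset [set w : {ffun F -> T} | (#|[set i | w i != w0 i]%SET| <= n)%N]%SET.
  apply/fintype.subsetP => w; rewrite !inE => -[x [cx ax wE]].
  rewrite truncn_ge_nat ?mulr_ge0//.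
  have /le_trans -> // : (#|[set i | w i != w0 i]%SET|%:R : R) <=
      #|[set i : F | `[< B (act (val i) x) >]]%SET|%:R
      + #|[set i : F | `[< B (act (val i) x0) >]]%SET|%:R; last first.
    by rewrite -!visits; lra.
  rewrite -natrD ler_nat.
  apply: leq_trans (leq_card_setU _ _).1; apply/subset_leq_card/fintype.subsetP => i.
  rewrite !inE; apply: contraNT; rewrite negb_or => /andP[/asboolPn nx /asboolPn nx0].
  rewrite -wE -w0E !ffunE; apply/eqP; apply: sep => //.
  have := metric_triangle (act (val i) x) (act (val i) c) (act (val i) x0).
  have := cx0 _ (valP i); have := cx _ (valP i).
  by rewrite [mdist (act _ x) (act _ c)]metric_sym; lra.
have := hamming_ball_card w0 n r0 r1; rewrite -cardfE => h.
have lnr : ln r <= 0 by exact: ln_le0.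
have nr : 0 < r ^+ n by exact: exprn_gt0.
rewrite -(ler_pM2r nr) expRD.
apply: (@le_trans _ _ (expR (#|T|%:R * r * #|` F|%:R))).
  by apply: le_trans h; rewrite ler_wpM2r ?(ltW nr)// ler_nat subset_leq_card.
rewrite -[leRHS]mulrA ler_peMr ?expR_ge0//.
rewrite -[X in X ^+ n](lnK r0) -expRM_natl -expRD -[leLHS]expR0 ler_expR.
have n2a : n%:R - 2 * a <= 0 by rewrite subr_le0 truncn_le ?mulr_ge0.
by have := mulr_le0 n2a lnr; lra.
Qed.

(** Let A be covered by k Bowen balls. By Markov's inequality, the points
    of A that seldom visit B have positive mass; their names lie in k Hamming
    balls. The lower bound on the number of names of positive mass is the last
    hypothesis. *)
Lemma covering_number_lower (F : nat -> {fset G}) (hr delta eta : R) :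
  0 < delta < 1 -> 0 < eta -> (forall N, F N != fset0) ->
  (forall beta eta, 0 < beta -> 0 < eta -> exists N0 : nat,
    forall N, (N0 <= N)%N -> forall Q : {set {ffun F N -> T}},
    beta <= \sum_(w in Q) nameP w ->
    expR (#|` F N|%:R * (hr - eta)) <= #|Q|%:R) ->
  exists2 e0, 0 < e0 & forall e, e <= e0 -> exists N0 : nat,
    forall N, (N0 <= N)%N ->
    ((expR (#|` F N|%:R * (hr - eta)))%:E <= covering_number act mu (F N) e delta)%E.
Proof.
move=> /andP[d0 d1] eta0 F0 many.
have beta0 : 0 < (1 - delta) / 2 by rewrite divr_gt0// subr_gt0.
have eta2 : 0 < eta / 2 by rewrite divr_gt0.
(* The weight r and the frequency a are chosen so that a Hamming ball of
   radius 2 a |F| has at most exp (|F| eta / 2) elements. *)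
pose n : R := #|T|%:R; have n0 : 0 <= n by [].
pose r := eta / (4 * n + eta).
have D0 : 0 < 4 * n + eta by rewrite ltr_wpDl// mulr_ge0.
have r0 : 0 < r by rewrite divr_gt0.
have r1 : r <= 1 by rewrite ler_pdivrMr// mul1r lerDr mulr_ge0.
have nr : n * r <= eta / 4.
  by rewrite /r mulrA ler_pdivrMr//; nra.
have lnr : ln r <= 0 by exact: ln_le0.
pose a := eta / (8 * (1 - ln r)).
have D1 : 0 < 8 * (1 - ln r) by rewrite mulr_gt0//; lra.
have a0 : 0 < a by rewrite divr_gt0.
have ar : 2 * a * - ln r <= eta / 4.
  rewrite /a mulrA mulrAC ler_pdivrMr//; nra.
have k0 : 0 < a * ((1 - delta) / 2) by rewrite mulr_gt0.
have [e1 [B [e10 mB Bk sep]]] := label_separation k0.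
exists (e1 / 2); first by rewrite divr_gt0.
move=> e ee; have [N0 hN0] := many _ _ beta0 eta2.
exists N0 => N /hN0 hN; apply: covering_number_ge => k c A mA Asub hA.
have sepe (x y : X) : ~ B x -> ~ B y -> mdist x y < 2 * e -> p x = p y.
  by move=> nx ny xy; apply: sep => //; lra.
pose f x : R := \sum_(g <- F N) \1_B (act g x).
have FN0 : 0 < #|` F N|%:R :> R by rewrite ltr0n cardfs_gt0.
pose aN := #|` F N|%:R * a.
have aN0 : 0 < aN by rewrite mulr_gt0.
have bB : bdd_measurable (\1_B : borel X -> R) by exact: bdd_measurable_indic.
have bg g : bdd_measurable (fun x : borel X => \1_B (act g x) : R).
  exact: bdd_measurable_comp (mact g) bB.
have bf : bdd_measurable (f : borel X -> R) by exact: bdd_measurable_sum.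
have meanf : mean mu f <= #|` F N|%:R * (a * ((1 - delta) / 2)).
  rewrite /f mean_sum//.
  rewrite (eq_bigr (fun=> pr mu B)) => [|g _]; last first.
    by rewrite -mean_indic//; exact: (mean_act mact inv g bB).
  by rewrite big_const_seq count_predT iter_addr_0 -[leLHS]mulr_natl ler_wpM2l.
pose Bad : set (borel X) := [set x | aN <= f x]%classic.
have mBad : measurable Bad by exact: measurable_superlevel.
have prBad : pr mu Bad <= (1 - delta) / 2.
  apply: (le_trans (pr_markov mu bf aN0 _)) => [x|].
    by apply: sumr_ge0 => g _; rewrite indicE.
  by rewrite ler_pdivrMr// (le_trans meanf)// /aN mulrA [leRHS]mulrC.
pose Qi (x : X) : {set {ffun F N -> T}} := [set w : {ffun F N -> T} |
  `[< exists y, [/\ bowen_ball act (F N) x e y, f y <= aN & nameB (F N) y = w] >]].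
have Qic x : #|Qi x|%:R <= expR (#|` F N|%:R * (eta / 2)).
  apply: (le_trans (names_in_bowen_ball _ _ _ sepe r0 r1)).
  rewrite ler_expR /aN -/n.
  have : #|` F N|%:R * (n * r + 2 * a * - ln r) <= #|` F N|%:R * (eta / 2).
    by rewrite ler_wpM2l//; lra.
  by lra.
pose Q : {set {ffun F N -> T}} := \bigcup_(i < k) Qi (c i).
have Qc : #|Q|%:R <= k%:R * expR (#|` F N|%:R * (eta / 2)).
  apply: (@le_trans _ _ (\sum_(i < k) #|Qi (c i)|)%:R).
    rewrite ler_nat; apply: (big_ind2 (fun (U : {set {ffun F N -> T}}) m => #|U| <= m)%N) => //.
      by rewrite cards0.
    move=> U m V l Um Vl; apply: leq_trans (leq_card_setU _ _).1 _; exact: leq_add.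
  rewrite natr_sum (le_trans (ler_sum _ (fun i _ => Qic (c i))))//.
  by rewrite sumr_const card_ord -[leLHS]mulr_natl.
have Qm : (1 - delta) / 2 <= \sum_(w in Q) nameP w.
  rewrite -(pr_name mu mact mp).
  have : pr mu A <= pr mu (nameB (F N) @^-1` [set` Q] `|` Bad)%classic.
    apply: pr_le => //; first by apply: measurableU => //; exact: measurable_name.
    move=> x Ax; have [|nx] := pselect (Bad x); [by right|left].
    have [i _ cix] := Asub _ Ax.
    rewrite /= /Q; apply/bigcupP; exists i => //.
    rewrite inE; apply/asboolP; exists x; split => //.
    by move: nx; rewrite /Bad/= => /negP; rewrite -ltNge => /ltW.
  have := prU_le mu (measurable_name mact mp [set` Q]%classic) mBad.
  by lra.
have := hN _ Qm => /le_trans /(_ Qc).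
rewrite -ler_pdivrMr ?expR_gt0// -expRN -expRD.
by apply: le_trans; rewrite ler_expR; lra.
Qed.

End Covering.

(** * Limits inferior in the extended reals *)

Section LimitInferior.
Local Open Scope classical_set_scope.
Local Open Scope ring_scope.
Context {R : realType}.
Implicit Types (u : (\bar R)^nat) (l : \bar R).
Local Open Scope ereal_scope.

Lemma limn_einfE u : limn_einf u = ereal_sup (range (einfs u)).
Proof. by rewrite limn_einf_lim; apply/cvg_lim => //; exact: cvg_einfs_sup. Qed.

Lemma limn_einf_ge u l (N0 : nat) :
  (forall n, (N0 <= n)%N -> l <= u n) -> l <= limn_einf u.
Proof.
move=> h; rewrite limn_einfE; apply: (@le_trans _ _ (einfs u N0)).
  by apply: le_ereal_inf_tmp => _ [n /= Nn <-]; exact: h.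
by apply: ereal_sup_ubound; exists N0.
Qed.

Lemma limn_esup_le u l (N0 : nat) :
  (forall n, (N0 <= n)%N -> u n <= l) -> limn_esup u <= l.
Proof.
move=> h; rewrite -[limn_esup u]oppeK -limn_einfN leeNl.
by apply: (@limn_einf_ge _ _ N0) => n /h; rewrite /= leeN2.
Qed.

Lemma limn_einf_gt_near u l : l < limn_einf u ->
  exists N0 : nat, forall n, (N0 <= n)%N -> l <= u n.
Proof.
rewrite limn_einfE => /ereal_sup_gt[_ [N0 _ <-] lN0].
exists N0 => n Nn; rewrite (le_trans (ltW lN0))//.
by apply: ereal_inf_lbound; exists n.
Qed.

Lemma limn_einf_lt_often u l : limn_einf u < l ->
  forall N0 : nat, exists n, (N0 <= n)%N /\ u n <= l.
Proof.
move=> ul N0; have : einfs u N0 < l.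
  apply: le_lt_trans ul; rewrite limn_einfE; apply: ereal_sup_ubound.
  by exists N0.
by move=> /ereal_inf_lt[_ [n /= Nn <-] /ltW unl]; exists n.
Qed.

(** This form treats finite and infinite limits alike. *)
Lemma cvg_right0_squeeze (L : R -> \bar R) (h : \bar R) :
  (forall e : R, (0 < e)%R -> L e <= h) ->
  (forall M : R, M%:E < h -> exists2 e0 : R, (0 < e0)%R &
     forall e : R, (0 < e)%R -> (e <= e0)%R -> M%:E <= L e) ->
  L e @[e --> 0%R^'+] --> h.
Proof.
move=> Lh hL.
have nearL M : M%:E < h -> \forall e \near (0%R : R)^'+, M%:E <= L e <= h.
  move=> /hL[e0 e00 h0]; near=> e.
  have e_gt0 : (0 < e)%R by [].
  rewrite Lh// andbT; apply: h0 => //; near: e; exact: nbhs_right_le.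
case: h Lh hL nearL => [r| |] Lh hL nearL.
- apply/fine_cvgP; split.
    have : (r - 1)%:E < r%:E by rewrite lte_fin ltrBlDr ltrDl.
    move=> /nearL; apply: filterS => e /andP[e1 e2].
    by rewrite fin_numElt (lt_le_trans (ltNyr _) e1) (le_lt_trans e2 (ltry _)).
  apply/cvgrPdist_le => e e0.
  have : (r - e)%:E < r%:E by rewrite lte_fin ltrBlDr ltrDl.
  move=> /nearL; apply: filterS => x /=; case: (L x) => [y| |] /=;
    [|by rewrite leye_eq andbF|by []].
  by rewrite !lee_fin ler_distlC => /andP[-> h]; rewrite (le_trans h)// lerDl ltW.
- apply/cvgeyPge => M; have /nearL : M%:E < +oo by rewrite ltry.
  by apply: filterS => e /andP[].
- apply/cvgeNyPle => M; near=> e.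
  by rewrite (le_trans (Lh e _))// leNye.
Unshelve. all: by end_near. Qed.

End LimitInferior.

(** * Partitions, labels and entropy *)

Section Partitions.
Local Open Scope classical_set_scope.
Local Open Scope ring_scope.
Context {R : realType} {G : groupType} {X : pointedMetricType R}.
Variables (act : G -> X -> X) (mu : probability (borel X) R).

(** The labels are the members of P themselves. *)
Lemma partition_label (P : set (set (borel X))) : finite_measurable_partition P ->
  exists (T : finType) (p : X -> T),
    (forall t, measurable (p @^-1` [set t] : set (borel X))) /\
    P = range (fun t => p @^-1` [set t]).
Proof.
move=> [finP mP [covP trivP neP]].
pose T := fset_sub_type (fset_set P).
have TP (t : T) : P (fsval t) by have := valP t; rewrite in_fset_set// inE.
have /choice[p pE] (x : X) : exists t : T, fsval t x.
  have : cover P id x by rewrite covP.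
  move=> [A PA Ax]; have AT : A \in fset_set P by rewrite in_fset_set// inE.
  by exists [` AT]%fset.
have cell t : p @^-1` [set t] = fsval t.
  apply/seteqP; split => [x /= <-|x tx /=]; first exact: pE.
  apply: val_inj; apply: (trivP _ _ (TP _) (TP _)).
  by exists x; split => //; exact: pE.
exists T, p; split => [t|]; first by rewrite cell; exact: mP (TP t).
apply/seteqP; split => [A PA|_ [t _ <-]]; last by rewrite cell; exact: TP.
have AT : A \in fset_set P by rewrite in_fset_set// inE.
by exists [` AT]%fset => //; rewrite cell.
Qed.

Context {T : finType} (p : X -> T).
Hypothesis mp : forall t, measurable (p @^-1` [set t] : set (borel X)).
Hypothesis mact : forall g,
  measurable_fun [set: borel X] (act g : borel X -> borel X).
Local Notation P := (range (fun t => p @^-1` [set t]) : set (set (borel X))).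
Local Notation nameB := (@name _ (borel X) G act T p).

(** An inductive form over duplicate-free lists of [refine_names]; the cells are
    indexed by functions on the whole group so that the index type does not
    change along the induction. *)
Lemma refine_cells (s : seq G) : uniq s ->
  \big[@join R X/[set setT]]_(g <- s) [set act g @^-1` A | A in P] =
  range (fun w : G -> T => [set x | forall g, g \in s -> p (act g x) = w g]).
Proof.
elim: s => [_|g s IH /= /andP[gs us]].
  rewrite big_nil; apply/seteqP; split => [_ ->|_ [w _ <-]] /=.
    by exists (fun=> p point) => //; apply/seteqP; split.
  by apply/seteqP; split.
rewrite big_cons IH//; apply/seteqP; split.
  move=> _ [_ [_ [t _ <-] <-] [_ [w _ <-] <-]].
  exists (fun h => if h == g then t else w h) => //.
  apply/seteqP; split => [x /= h|x /= [gt h] k].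
    split; first by have := h g (mem_head _ _); rewrite eqxx.
    move=> k ks; have := h k; rewrite inE ks orbT => /(_ isT).
    by case: eqP => // kg; move: gs; rewrite -kg ks.
  rewrite inE => /predU1P[->|ks]; first by rewrite eqxx.
  by case: eqP => [->//|_]; exact: h.
move=> _ [w _ <-]; exists (act g @^-1` (p @^-1` [set w g])).
  by exists (p @^-1` [set w g]) => //; exists (w g).
exists [set x | forall h, h \in s -> p (act h x) = w h]; first by exists w.
apply/seteqP; split => [x /= [gx h] k|x /= h].
  by rewrite inE => /predU1P[->|] //; exact: h.
split; first by apply: h; exact: mem_head.
by move=> k ks; apply: h; rewrite inE ks orbT.
Qed.

Lemma refine_names (F : {fset G}) :
  refine act P F = range (fun w => nameB F @^-1` [set w]).
Proof.
rewrite /refine refine_cells ?fset_uniq//; apply/seteqP; split => _ [w _ <-].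
  exists [ffun i : F => w (val i)] => //; apply/seteqP; split => x /=.
    by move=> /ffunP h g gF; have := h [` gF]%fset; rewrite !ffunE.
  by move=> h; apply/ffunP => i; rewrite !ffunE; apply: h; exact: valP.
exists (fun g => oapp w (p point) (insub g)) => //; apply/seteqP; split => x /=.
  move=> h; apply/ffunP => i; rewrite ffunE h; last exact: valP.
  by rewrite valK.
by move=> <- g gF; rewrite (insubT (fun g => g \in F) gF) /= ffunE.
Qed.

(** Distinct names have distinct cells unless these are empty, and an empty cell
    contributes nothing to either sum. *)
Lemma partition_entropy_names (F : {fset G}) :
  partition_entropy mu (refine act P F) = @name_entropy _ (borel X) R mu G act T p F.
Proof.
rewrite /partition_entropy /name_entropy refine_names; congr (- _).
pose c (w : {ffun F -> T}) : set (borel X) := nameB F @^-1` [set w].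
pose f (A : set (borel X)) := fine (mu A) * ln (fine (mu A)).
pose W := [set w | c w !=set0].
have f0 : f set0 = 0 by rewrite /f measure0 mul0r.
transitivity (\sum_(A \in c @` W) f A).
  apply/esym/fsbig_widen; first by move=> _ [w _ <-]; exists w.
  move=> _ [[w _ <-] nW]; rewrite /=.
  have [w0|/set0P w0] := eqVneq (c w) set0; first by rewrite -/(c w) w0.
  by case: nW; exists w.
rewrite (@reindex_fsbig _ _ _ _ _ c W); last first.
  apply/inj_bij => w w' /set_mem[x /= xw] _ /seteqP[/(_ _ xw)] /= xw' _.
  by rewrite -xw -xw'.
rewrite (@fsbig_widen _ _ _ _ W setT) //; last first.
  move=> w [_ nW] /=.
  have [-> //|/set0P w0] := eqVneq (c w) set0.
  by case: nW.
rewrite fsbig_finite//= -[RHS]big_enum; apply: perm_big; apply: uniq_perm.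
- exact: fset_uniq.
- exact: enum_uniq.
- move=> w; rewrite mem_enum in_fset_set; last exact: finite_finset.
  by rewrite (mem_set (A := setT)) ?inE.
Qed.

End Partitions.

(** * Covering rates and the entropy formula *)

Section CoveringRate.
Local Open Scope classical_set_scope.
Local Open Scope ring_scope.
Context {R : realType} {G : groupType} {X : pointedMetricType R}.
Variables (act : G -> X -> X) (mu : probability (borel X) R) (F : nat -> {fset G}).
Hypothesis F0 : forall n, F n != fset0.

(** Cover the space by finitely many balls of radius e / 2 and group the points
    according to the balls that contain them. *)
Lemma small_partition (e : R) : compact [set: X] -> 0 < e ->
  exists P : set (set (borel X)), finite_measurable_partition P /\
    forall (A : set (borel X)) (x y : X), P A -> A x -> A y -> mdist x y < e.
Proof.
move=> cX e0; have e2 : 0 < e / 2 by rewrite divr_gt0.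
have [D' _ covD] : finite_subset_cover setT (fun x : X => ball x (e / 2)) setT.
  move: cX; rewrite compact_cover; apply => [x _|x _]; first exact: open_mball.
  by exists x => //; exact: ballxx.
pose p (x : X) : {ffun D' -> bool} := [ffun c => `[< ball (val c) (e / 2) x >]].
exists [set A | exists x, A = p @^-1` [set p x]]; split; last first.
  move=> A x y [z ->] /= xz yz.
  have [c cD cx] := covD x I.
  have := cx; rewrite /= ballEmdist /= metric_sym => xc.
  have : ball c (e / 2) y.
    have : p x = p y by rewrite xz yz.
    move=> /ffunP/(_ [` cD]%fset); rewrite !ffunE /= => xy.
    by apply/asboolP; rewrite -xy; exact/asboolP.
  rewrite ballEmdist/= => cy; rewrite (le_lt_trans (metric_triangle x c y))//.
  by rewrite [e]splitr ltrD.
split.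
- have : finite_set (range (fun w : {ffun D' -> bool} => p @^-1` [set w])).
    exact/finite_image/finite_finset.
  by apply: sub_finite_set => A [x ->]; exists (p x).
- move=> _ [z ->].
  have -> : p @^-1` [set p z] = \bigcap_(c in [set: D'])
      (if p z c then ball (val c) (e / 2) else ~` ball (val c) (e / 2)).
    apply/seteqP; split => x /=.
      move=> <- c _; rewrite /p ffunE; case: ifPn => /asboolP //.
    move=> h; apply/ffunP => c; have := h c I; rewrite [RHS]ffunE /p !ffunE.
    case: ifPn => /asboolP h1 h2; last by rewrite !asboolF.
    by rewrite !asboolT.
  apply: fin_bigcap_measurable => [|c _]; first exact: finite_finset.
  have mb : measurable (ball (val c : X) (e / 2) : set (borel X)).
    by apply: open_borel; exact: open_mball.
  by case: ifP => // _; exact: measurableC.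
- split.
  + by apply/seteqP; split => // x _; exists (p @^-1` [set p x]) => //; exists x.
  + move=> _ _ [x ->] [y ->] [z [/= zx zy]].
    by rewrite -zx -zy.
  + by move=> _ [x ->]; exists x.
Qed.

Let Fgt0 n : 0 < #|` F n|%:R :> R.
Proof. by rewrite ltr0n cardfs_gt0. Qed.

Lemma covering_number_ge0 e delta n : (0 <= covering_number act mu (F n) e delta)%E.
Proof. by apply: le_ereal_inf_tmp => _ [k _ <-]; rewrite lee_fin. Qed.

Let lneX (a : R) : lne (expR a)%:E = a%:E.
Proof. by rewrite lne_EFin ?expR_gt0// expRK. Qed.

Lemma covering_rate_le e delta n (a : R) :
  (covering_number act mu (F n) e delta <= (expR (#|` F n|%:R * a))%:E)%E ->
  (covering_rate act mu F e delta n <= a%:E)%E.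
Proof.
move=> h; rewrite /covering_rate.
have -> : a%:E = ((#|` F n|%:R)^-1%:E * lne (expR (#|` F n|%:R * a))%:E)%E.
  by rewrite lneX -EFinM mulrA mulVf ?mul1r ?gt_eqF.
rewrite lee_wpmul2l ?lee_fin ?invr_ge0//.
by rewrite lee_lne ?in_itv/= ?leey ?andbT ?covering_number_ge0 ?lee_fin ?expR_ge0.
Qed.

Lemma covering_rate_ge e delta n (a : R) :
  ((expR (#|` F n|%:R * a))%:E <= covering_number act mu (F n) e delta)%E ->
  (a%:E <= covering_rate act mu F e delta n)%E.
Proof.
move=> h; rewrite /covering_rate.
have -> : a%:E = ((#|` F n|%:R)^-1%:E * lne (expR (#|` F n|%:R * a))%:E)%E.
  by rewrite lneX -EFinM mulrA mulVf ?mul1r ?gt_eqF.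
rewrite lee_wpmul2l ?lee_fin ?invr_ge0//.
by rewrite lee_lne ?in_itv/= ?leey ?andbT ?covering_number_ge0 ?lee_fin ?expR_ge0.
Qed.

Context {T : finType} (p : X -> T).
Hypothesis mp : forall t, measurable (p @^-1` [set t] : set (borel X)).
Hypothesis mact : forall g,
  measurable_fun [set: borel X] (act g : borel X -> borel X).
Local Notation P := (range (fun t => p @^-1` [set t]) : set (set (borel X))).
Local Notation H := (@name_entropy _ (borel X) R mu G act T p).

Lemma name_entropy_ge0 (K : {fset G}) : 0 <= H K.
Proof.
rewrite oppr_ge0 sumr_le0// => w _.
by rewrite mulr_ge0_le0 ?nameP_ge0// ln_le0// nameP_le1.
Qed.

Lemma name_entropy_le (K : {fset G}) : H K <= #|` K|%:R * ln #|T|%:R.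
Proof.
have T0 : (0 < #|T|)%N by exact: (@label_card_gt0 _ (borel X) _ p).
have W0 : 0 < #|{: {ffun K -> T}}|%:R :> R.
  by rewrite ltr0n card_ffun expn_gt0 T0.
apply: (le_trans (gibbs (r := fun=> #|{: {ffun K -> T}}|%:R^-1) _ _ _ _)).
- by move=> w; exact: nameP_ge0.
- exact: sum_nameP.
- by move=> w; rewrite invr_gt0.
- by rewrite sumr_const -[leLHS]mulr_natl divff ?gt_eqF.
rewrite -mulr_suml sum_nameP// mul1r lnV ?posrE// opprK.
by rewrite card_ffun natrX lnXn ?ltr0n// -[leLHS]mulr_natl cardfE.
Qed.

(** The normalised entropies lie between 0 and ln #|T|, so their limit inferior
    is a real number. *)
Lemma entropy_of_real : exists hr : R, [/\ entropy_of act mu F P = hr%:E, 0 <= hr,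
  forall eta, 0 < eta -> exists N0 : nat, forall N, (N0 <= N)%N ->
    #|` F N|%:R * (hr - eta) <= H (F N) &
  forall eta, 0 < eta -> forall N0 : nat, exists N,
    (N0 <= N)%N /\ H (F N) <= #|` F N|%:R * (hr + eta)].
Proof.
have uE : entropy_of act mu F P = limn_einf (fun n => ((#|` F n|%:R)^-1 * H (F n))%:E).
  rewrite /entropy_of; congr limn_einf; apply/funext => n.
  by rewrite partition_entropy_names.
rewrite uE; set u := (X in limn_einf X).
have lo : (0 <= limn_einf u)%E.
  apply: (@limn_einf_ge _ _ _ 0%N) => n _; rewrite lee_fin mulr_ge0 ?invr_ge0//.
  exact: name_entropy_ge0.
have hi : (limn_einf u <= (ln #|T|%:R)%:E)%E.
  apply: (le_trans (limn_einf_sup _)); apply: (@limn_esup_le _ _ _ 0%N) => n _.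
  by rewrite lee_fin ler_pdivrMl// name_entropy_le.
have fin : limn_einf u \is a fin_num.
  by rewrite fin_numElt (lt_le_trans (ltNyr 0) lo) (le_lt_trans hi (ltry _)).
exists (fine (limn_einf u)); split.
- by rewrite fineK.
- exact: fine_ge0.
- move=> eta eta0.
  have [|N0 hN0] := @limn_einf_gt_near _ u (fine (limn_einf u) - eta)%:E.
    by rewrite -[ltRHS]fineK// lte_fin ltrBlDr ltrDl.
  by exists N0 => N /hN0; rewrite lee_fin ler_pdivlMl.
- move=> eta eta0 N0.
  have [|n [Nn hn]] := @limn_einf_lt_often _ u (fine (limn_einf u) + eta)%:E _ N0.
    by rewrite -[ltLHS]fineK// lte_fin ltrDl.
  by exists n; split => //; move: hn; rewrite lee_fin ler_pdivrMl.
Qed.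

End CoveringRate.

Local Open Scope classical_set_scope.
Local Open Scope ring_scope.

Lemma unbounded_of_log_ratio (R : realType) (a : nat -> R) : (forall n, 0 <= a n) ->
  (a n / ln n%:R : R) @[n --> \oo] --> +oo ->
  forall x : R, exists N0 : nat, forall n, (N0 <= n)%N -> x <= a n.
Proof.
move=> a0 /cvgryPge ha x.
have [N1 _ h1] := ha x.
have [N2 _ h2] := nbhs_infty_ger (expR 1 : R).
exists (maxn N1 N2) => n; rewrite geq_max => /andP[/h1/= hn /h2/= en].
have ln1 : 1 <= ln n%:R :> R.
  by rewrite -[leLHS]expRK ler_ln ?posrE ?expR_gt0// (lt_le_trans _ en)// expR_gt0.
apply: (le_trans hn); rewrite ler_pdivrMr ?(lt_le_trans ltr01)//.
by rewrite ler_peMr.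
Qed.

Theorem theorem3p1 (R : realType) (G : groupType) (X : pointedMetricType R)
    (act : G -> X -> X) (mu : probability (borel X) R) (F : nat -> {fset G}) :
  countable [set: G] ->
  amenable R G ->
  compact [set: X] ->
  continuous_action act ->
  ergodic act mu ->
  Folner R F ->
  tempered R F ->
  (#|` F n|%:R / ln n%:R : R) @[n --> \oo] --> +oo ->
  forall delta : R, 0 < delta < 1 ->
    limn_einf (covering_rate act mu F e delta) @[e --> 0^'+]
      --> measure_entropy act mu F /\
    limn_esup (covering_rate act mu F e delta) @[e --> 0^'+]
      --> measure_entropy act mu F.
Proof.
move=> Gcount _ cX [act1 actM actC] [inv erg] Ffol _ Fln delta d01.
have mact g : measurable_fun [set: borel X] (act g : borel X -> borel X).
  exact: continuous_borel.
have Fcard := unbounded_of_log_ratio (fun n => ler0n _ _) Fln.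
have F0 := Ffol.1.
have upper e : 0 < e ->
    (limn_esup (covering_rate act mu F e delta) <= measure_entropy act mu F)%E.
  move=> e0; have [P [Ppart Psmall]] := small_partition cX e0.
  have : (entropy_of act mu F P <= measure_entropy act mu F)%E.
    by apply: ereal_sup_ubound; exists P.
  have [T [p [mp PE]]] := partition_label Ppart.
  have [hr [hrE hr0 hr_le hr_ge]] := entropy_of_real mu F0 mp mact.
  rewrite PE hrE; apply: le_trans; apply/lee_addgt0Pr => eta eta0.
  have [d0 _] := andP d01.
  have m0 : 0 < Num.min eta delta by rewrite lt_min eta0.
  have [N0 hN0] := typical_names_rate (Y := borel X) act1 actM mact inv Gcount erg Ffol mp hr_ge Fcard m0.
  apply: (@limn_esup_le _ _ _ N0) => n /hN0[S [S1 S2]].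
  rewrite -EFinD; apply: covering_rate_le => //.
  have S3 : 1 - delta <= \sum_(w in S) @nameP _ (borel X) R mu G act T p (F n) w.
    by apply: le_trans S2; rewrite lerD2l lerN2 ge_min lexx orbT.
  apply: (le_trans (covering_number_le mp mact _ S3)).
    move=> x y xy; apply: (Psmall (p @^-1` [set p x])) => //.
    by rewrite PE; exists (p x).
  rewrite lee_fin (le_trans S1)// ler_expR ler_wpM2l// lerD2l ge_min lexx //.
have lower M : (M%:E < measure_entropy act mu F)%E -> exists2 e0 : R, 0 < e0 &
    forall e, 0 < e -> e <= e0 -> (M%:E <= limn_einf (covering_rate act mu F e delta))%E.
  move=> /ereal_sup_gt[_ [P Ppart <-]].
  have [T [p [mp PE]]] := partition_label Ppart.
  have [hr [hrE hr0 hr_le hr_ge]] := entropy_of_real mu F0 mp mact.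
  rewrite PE hrE lte_fin => Mhr.
  have eta0 : 0 < hr - M by rewrite subr_gt0.
  have [e0 e00 he0] := covering_number_lower mp mact inv d01 eta0 F0
    (many_names (Y := borel X) act1 actM mact inv Gcount erg Ffol mp hr0 hr_le hr_ge Fcard).
  exists e0 => // e _ /he0[N0 hN0]; apply: (@limn_einf_ge _ _ _ N0) => n /hN0.
  by rewrite subKr => /covering_rate_ge; exact.
split; apply: cvg_right0_squeeze => [e e0|M /lower[e0 e00 h]].
- exact: le_trans (limn_einf_sup _) (upper e e0).
- by exists e0.
- exact: upper.
- by exists e0 => // e e_gt0 ee0; rewrite (le_trans (h e e_gt0 ee0))// limn_einf_sup.
Qed.
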